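(* Let $G\subset\mathbb{K}[\mathbf{x}][\boldsymbol{\partial}]$ be a finite Gröbner basis with respect to $\prec$ such that $\mathbb{K}(\mathbf{x})[\boldsymbol{\partial}]G$ is D-finite, and let $d=\mathrm{rank}(G)$. Assume the origin is a singularity of $G$, and let $S$ be a set of initial exponent candidates of $G$ with $|S|\ge d$. Let $m=\max\{|\mathbf{u}|:\mathbf{u}\in S\}$ and $U_m=\{\mathbf{u}\in\mathbb{N}^n: |\mathbf{u}|\le m\}$. Then the following are equivalent: (i) the origin is an apparent singularity of $G$, i.e. $G$ has $d$ many $\mathbb{K}$-linearly independent formal power series solutions; (ii) there is a subset $B\subseteq S$ with $|B|=d$ such that the origin is an ordinary point of $M$, where $M\subset\mathbb{K}[\mathbf{x}][\boldsymbol{\partial}]$ is the Gröbner basis (with respect to $\prec$, elements normalized to be primitive operators with polynomial coefficients) of the left ideal $$\mathbb{K}(\mathbf{x})[\boldsymbol{\partial}]G\ \cap\bigcap_{\mathbf{u}\in U_m\setminus B}\mathbb{K}(\mathbf{x})[\boldsymbol{\partial}]\{x_i\partial_i-u_i: 1\le i\le n\}.$$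
   Context: $\mathbb{K}$ is a field of characteristic zero; $\mathbb{K}(\mathbf{x})[\boldsymbol{\partial}]$ and $\mathbb{K}[\mathbf{x}][\boldsymbol{\partial}]$ are the rings of partial differential operators in $\partial_1,\dots,\partial_n$ with rational, resp. polynomial, coefficients in $x_1,\dots,x_n$. A left ideal is D-finite if the quotient is finite-dimensional over $\mathbb{K}(\mathbf{x})$. $\prec$ is a fixed graded term order on $\mathbb{N}^n$, used on $\boldsymbol{\partial}$-terms and on $\mathbf{x}$-terms. For a Gröbner basis $G$: head term, head coefficient (in $\mathbb{K}[\mathbf{x}]$), parametric terms (terms not divisible by any head term), $\mathrm{rank}(G)$ = number of parametric terms. Singularities of $G=\{G_1,\dots,G_k\}$: zeros in $\overline{\mathbb{K}}^n$ of the lcm of the head coefficients; other points are ordinary. Primitive operator: gcd of its polynomial coefficients is $1$. Formal power series solution: $f\in\mathbb{K}[[\mathbf{x}]]$ annihilated by every element of $G$; initial exponent of nonzero $f$: $\prec$-smallest exponent occurring in $f$. $|\mathbf{u}|=u_1+\dots+u_n$. Indicial polynomial: let $\delta_i=x_i\partial_i$. For nonzero $P=\sum_{|\mathbf{u}|\le m}c_{\mathbf{u}}\boldsymbol{\partial}^{\mathbf{u}}\in\mathbb{K}[\mathbf{x}][\boldsymbol{\partial}]$ of order $m$ (some $c_{\mathbf{u}}\neq0$ with $|\mathbf{u}|=m$), with $\mathbf{m}=(m,\dots,m)$ write uniquely $\mathbf{x}^{\mathbf{m}}P=\sum_{\mathbf{v}\in T}\mathbf{x}^{\mathbf{v}}\big(\sum_{|\mathbf{u}|\le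 m}c_{\mathbf{u},\mathbf{v}}\boldsymbol{\delta}^{\mathbf{u}}\big)$ with $c_{\mathbf{u},\mathbf{v}}\in\mathbb{K}$ and each inner sum nonzero; if $\mathbf{v}_0$ is the $\prec$-minimal element of $T$, then $\mathrm{ind}(P)=\sum_{|\mathbf{u}|\le m}c_{\mathbf{u},\mathbf{v}_0}\mathbf{y}^{\mathbf{u}}\in\mathbb{K}[y_1,\dots,y_n]$; $\mathrm{ind}(0)=0$. The indicial ideal is $\mathrm{ind}(G)=\{\mathrm{ind}(P):P\in\mathbb{K}(\mathbf{x})[\boldsymbol{\partial}]G\cap\mathbb{K}[\mathbf{x}][\boldsymbol{\partial}]\}$. If $\langle f_1,\dots,f_\ell\rangle\subseteq\mathrm{ind}(G)$ is a zero-dimensional ideal of $\mathbb{K}[\mathbf{y}]$, then $\{\mathbf{w}\in\mathbb{N}^n: f_i(\mathbf{w})=0,\ 1\le i\le\ell\}$ is called a set of initial exponent candidates of $G$. When the origin is a singularity of $G$, it is called apparent if $G$ has $\mathrm{rank}(G)$ many $\mathbb{K}$-linearly independent formal power series solutions. *)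

(* Defs.v *)
From HB Require Import structures.
From mathcomp Require Import all_boot all_order all_algebra.
From mathcomp Require Import mpoly.
Set Implicit Arguments. Unset Strict Implicit. Unset Printing Implicit Defensive.
Import Order.TTheory GRing.Theory.
Local Open Scope ring_scope.

(* Conventions.
   - Polynomials K[x] (and K[y]) : {mpoly K[n]}.
   - Operators K[x][d] : {mpoly {mpoly K[n]}[n]}; the outer variables are
     d_1..d_n, an operator is stored in normal form  sum_u c_u(x) d^u
     (coefficients on the left).  Only the additive structure and the
     coefficient/support functions of this mpoly type are used; the
     (noncommutative) operator product is [opmul] below.
   - Exponent vectors (in N^n) : 'X_{1..n}. *)

Definition graded_term_order (n : nat) (lt : rel 'X_{1..n}) :=
  [/\ irreflexive lt, transitive lt,
      (forall u v, u != v -> lt u v || lt v u),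
      (forall u v w, lt u v -> lt (u + w)%MM (v + w)%MM) &
      (forall u v, (mdeg u < mdeg v)%N -> lt u v)].

(* head term (the lt-largest exponent of the support; 0 for P = 0) *)
Definition hterm (R : ringType) (n : nat) (lt : rel 'X_{1..n})
    (P : {mpoly R[n]}) : 'X_{1..n} :=
  foldr (fun a b => if lt a b then b else a) 0%MM (msupp P).

Definition hcoeff (R : ringType) (n : nat) (lt : rel 'X_{1..n})
    (P : {mpoly R[n]}) : R := P@_(hterm lt P).

(* left multiplication by d_i :  d_i (c d^u) = c d^(u+e_i) + (d_i c) d^u *)
Definition dleft (K : fieldType) (n : nat) (i : 'I_n)
    (P : {mpoly {mpoly K[n]}[n]}) : {mpoly {mpoly K[n]}[n]} :=
  \sum_(u <- msupp P)
     ((P@_u) *: 'X_[(u + U_(i))%MM] + ((P@_u)^`M(i)) *: 'X_[u]).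

Definition dmon (K : fieldType) (n : nat) (u : 'X_{1..n})
    (P : {mpoly {mpoly K[n]}[n]}) : {mpoly {mpoly K[n]}[n]} :=
  foldr (fun i Q => iter (u i) (dleft i) Q) P (enum 'I_n).

Definition opmul (K : fieldType) (n : nat) (r g : {mpoly {mpoly K[n]}[n]})
  : {mpoly {mpoly K[n]}[n]} :=
  \sum_(u <- msupp r) (r@_u) *: dmon u g.

Definition in_lideal (K : fieldType) (n : nat)
    (G : seq {mpoly {mpoly K[n]}[n]}) (P : {mpoly {mpoly K[n]}[n]}) :=
  exists rs : seq {mpoly {mpoly K[n]}[n]},
    size rs = size G /\
    P = \sum_(i < size G) opmul (nth 0 rs i) (nth 0 G i).

(* P (an operator with polynomial coefficients) lies in K(x)[d] G, i.e. in
   K(x)[d] G  /\  K[x][d]: some nonzero polynomial multiple c P (c on the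
   left, i.e. clearing the denominators of the rational cofactors) lies in
   K[x][d] G. *)
Definition in_rlideal (K : fieldType) (n : nat)
    (G : seq {mpoly {mpoly K[n]}[n]}) (P : {mpoly {mpoly K[n]}[n]}) :=
  exists c : {mpoly K[n]}, c != 0 /\ in_lideal G (c *: P).

(* D-finiteness of K(x)[d] G : the quotient is spanned over K(x) by the
   finitely many classes of d^v, |v| <= N. *)
Definition dfinite (K : fieldType) (n : nat) (G : seq {mpoly {mpoly K[n]}[n]}) :=
  exists N : nat, forall u : 'X_{1..n},
    exists c : {mpoly K[n]}, exists Q : {mpoly {mpoly K[n]}[n]},
      [/\ c != 0, (forall v, v \in msupp Q -> (mdeg v <= N)%N) &
          in_rlideal G (c *: ('X_[u] : {mpoly {mpoly K[n]}[n]}) - Q)].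

(* Groebner bases (in K(x)[d], w.r.t. the term order on d-terms) of a left
   ideal L of K(x)[d], given through its polynomial part L /\ K[x][d]
   (every nonzero element of L has a polynomial multiple in L with the same
   head term). *)
Definition is_GB (K : fieldType) (n : nat) (lt : rel 'X_{1..n})
    (L : {mpoly {mpoly K[n]}[n]} -> Prop) (M : seq {mpoly {mpoly K[n]}[n]}) :=
  (forall g, g \in M -> g != 0 /\ L g) /\
  (forall P, P != 0 -> L P ->
     exists2 g, g \in M & (hterm lt g <= hterm lt P)%MM).

Definition parametric (K : fieldType) (n : nat) (lt : rel 'X_{1..n})
    (G : seq {mpoly {mpoly K[n]}[n]}) (u : 'X_{1..n}) : bool :=
  ~~ has (fun g => (hterm lt g <= u)%MM) G.

Definition is_rank (K : fieldType) (n : nat) (lt : rel 'X_{1..n})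
    (G : seq {mpoly {mpoly K[n]}[n]}) (d : nat) :=
  exists s : seq 'X_{1..n},
    [/\ uniq s, (forall u, (u \in s) = parametric lt G u) & size s = d].

Definition pdivides (K : fieldType) (n : nat) (p q : {mpoly K[n]}) :=
  exists r : {mpoly K[n]}, q = r * p.

Definition primitive_op (K : fieldType) (n : nat) (P : {mpoly {mpoly K[n]}[n]}) :=
  forall dv : {mpoly K[n]}, (forall u, pdivides dv (P@_u)) ->
    exists c : K, c != 0 /\ dv = c%:MP.

Definition is_reduced_GB (K : fieldType) (n : nat) (lt : rel 'X_{1..n})
    (L : {mpoly {mpoly K[n]}[n]} -> Prop) (M : seq {mpoly {mpoly K[n]}[n]}) :=
  [/\ is_GB lt L M, uniq M, (forall g, g \in M -> primitive_op g) &
      (forall g h u, g \in M -> h \in M -> u \in msupp g ->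
         (hterm lt h <= u)%MM -> g = h /\ u = hterm lt g)].

Definition is_lcm (K : fieldType) (n : nat) (ps : seq {mpoly K[n]}) (l : {mpoly K[n]}) :=
  (forall p, p \in ps -> pdivides p l) /\
  (forall q, (forall p, p \in ps -> pdivides p q) -> pdivides l q).

Definition singular0 (K : fieldType) (n : nat) (lt : rel 'X_{1..n})
    (G : seq {mpoly {mpoly K[n]}[n]}) :=
  exists l : {mpoly K[n]},
    is_lcm [seq hcoeff lt g | g <- G] l /\ l.@[fun _ => 0] = 0.

Definition ordinary0 (K : fieldType) (n : nat) (lt : rel 'X_{1..n})
    (G : seq {mpoly {mpoly K[n]}[n]}) := ~ singular0 lt G.

(* formal power series  f = sum_w f(w) x^w  and the action of operators *)
Definition fps (K : fieldType) (n : nat) := 'X_{1..n} -> K.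

Definition fps_der (K : fieldType) (n : nat) (u : 'X_{1..n}) (f : fps K n) : fps K n :=
  fun w => (\prod_(i < n) ((w i + u i) ^_ (u i)))%N%:R * f (w + u)%MM.

Definition fps_pmul (K : fieldType) (n : nat) (a : {mpoly K[n]}) (f : fps K n) : fps K n :=
  fun w => \sum_(v <- msupp a | (v <= w)%MM) a@_v * f (w - v)%MM.

Definition op_apply (K : fieldType) (n : nat) (P : {mpoly {mpoly K[n]}[n]})
    (f : fps K n) : fps K n :=
  fun w => \sum_(u <- msupp P) fps_pmul (P@_u) (fps_der u f) w.

Definition is_fps_sol (K : fieldType) (n : nat) (G : seq {mpoly {mpoly K[n]}[n]})
    (f : fps K n) :=
  forall g, g \in G -> forall w, op_apply g f w = 0.

Definition fps_lin_indep (K : fieldType) (n d : nat) (fs : 'I_d -> fps K n) :=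
  forall c : 'I_d -> K, (forall w, \sum_(i < d) c i * fs i w = 0) ->
    forall i, c i = 0.

Definition apparent0 (K : fieldType) (n : nat) (lt : rel 'X_{1..n})
    (G : seq {mpoly {mpoly K[n]}[n]}) (d : nat) :=
  singular0 lt G /\
  exists fs : 'I_d -> fps K n,
    (forall i, is_fps_sol G (fs i)) /\ fps_lin_indep fs.

Definition op_order (K : fieldType) (n : nat) (P : {mpoly {mpoly K[n]}[n]}) : nat :=
  \max_(u <- msupp P) mdeg u.

(* x^u d^u = prod_i y_i (y_i - 1) ... (y_i - u_i + 1)  with y_i = delta_i *)
Definition ffpoly (K : fieldType) (n : nat) (u : 'X_{1..n}) : {mpoly K[n]} :=
  \prod_(i < n) \prod_(j < u i) ('X_i - (j%:R)%:MP).

(* with mm = (m,..,m), m = order P:  x^mm P = sum_w x^w ind_part P w (delta) *)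
Definition ind_part (K : fieldType) (n : nat) (P : {mpoly {mpoly K[n]}[n]})
    (w : 'X_{1..n}) : {mpoly K[n]} :=
  let mm := [multinom op_order P | i < n] in
  \sum_(u <- msupp P) \sum_(v <- msupp (P@_u) | (v + (mm - u))%MM == w)
      (P@_u)@_v *: ffpoly K u.

Definition ind_exps (K : fieldType) (n : nat) (P : {mpoly {mpoly K[n]}[n]})
  : seq 'X_{1..n} :=
  let mm := [multinom op_order P | i < n] in
  [seq w <- [seq (v + (mm - u))%MM | u <- msupp P, v <- msupp (P@_u)]
     | ind_part P w != 0].

Definition ind (K : fieldType) (n : nat) (lt : rel 'X_{1..n})
    (P : {mpoly {mpoly K[n]}[n]}) : {mpoly K[n]} :=
  match ind_exps P with
  | [::] => 0
  | w0 :: ws => ind_part P (foldr (fun a b => if lt a b then a else b) w0 ws)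
  end.

Definition in_ind (K : fieldType) (n : nat) (lt : rel 'X_{1..n})
    (G : seq {mpoly {mpoly K[n]}[n]}) (p : {mpoly K[n]}) :=
  exists P, in_rlideal G P /\ ind lt P = p.

Definition in_ideal (K : fieldType) (n : nat) (fs : seq {mpoly K[n]}) (p : {mpoly K[n]}) :=
  exists gs : seq {mpoly K[n]},
    size gs = size fs /\ p = \sum_(i < size fs) nth 0 gs i * nth 0 fs i.

(* zero-dimensional: K[y] / <fs> is finite-dimensional over K *)
Definition zero_dim (K : fieldType) (n : nat) (fs : seq {mpoly K[n]}) :=
  exists N : nat, forall a : 'X_{1..n}, exists q : {mpoly K[n]},
    (forall b, b \in msupp q -> (mdeg b <= N)%N) /\ in_ideal fs ('X_[a] - q).

Definition is_cand_set (K : fieldType) (n : nat) (lt : rel 'X_{1..n})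
    (G : seq {mpoly {mpoly K[n]}[n]}) (S : seq 'X_{1..n}) :=
  uniq S /\
  exists fs : seq {mpoly K[n]},
    [/\ (forall p, in_ideal fs p -> in_ind lt G p), zero_dim fs &
        forall w : 'X_{1..n},
          (w \in S) = all (fun f => f.@[fun i => ((w i)%:R : K)] == 0) fs].

Definition euler_op (K : fieldType) (n : nat) (u : 'X_{1..n}) (i : 'I_n)
  : {mpoly {mpoly K[n]}[n]} :=
  ('X_i : {mpoly K[n]}) *: 'X_[U_(i)] - (u i)%:R.

Definition euler_ops (K : fieldType) (n : nat) (u : 'X_{1..n})
  : seq {mpoly {mpoly K[n]}[n]} :=
  [seq euler_op K u i | i <- enum 'I_n].

Definition inter_ideal (K : fieldType) (n : nat)
    (G : seq {mpoly {mpoly K[n]}[n]}) (m : nat) (B : seq 'X_{1..n})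
    (P : {mpoly {mpoly K[n]}[n]}) : Prop :=
  in_rlideal G P /\
  forall u : 'X_{1..n}, (mdeg u <= m)%N -> u \notin B ->
    in_rlideal (euler_ops K u) P.

(* Main.v *)
(** Let A = K[x][d] be the ring of operators with polynomial coefficients.

    From apparent to ordinary: the initial exponents of d independent solutions of G lie in S,
    because the indicial polynomial of an operator vanishes at the initial exponent of each of its
    solutions.  For d of them, forming B, complete the solutions by the monomials x^u, u in U_m - B.
    These solve the intersection ideal L and have all of U_m as initial exponents, so their
    Wronskian matrix is triangular at the origin, and no nonzero element of L is supported in U_m.
    As the rank of L is at most |U_m|, every v with |v| = m + 1 is the head term of a primitive
    element of L supported in U_m + {v}.  By Cramer's rule its head coefficient c divides all its
    coefficients in K[[x]], and eliminating a well-chosen variable shows that this contradicts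
    primitivity if c(0) = 0.

    From ordinary to apparent: let J be the intersection of A with K(x)[d]G.  Formal power series
    solutions of G are the linear forms on the fiber A / (x A + J) at the origin.  If the origin is
    an ordinary point of M, then A / J is finitely generated over the local ring K[x]_(0) by the
    parametric terms of M.  By Nakayama's lemma the dimension of its fiber at 0 is at least its
    rank d. *)

Require Import Defs.
From HB Require Import structures.
From mathcomp Require Import all_boot all_order all_algebra.
From mathcomp Require Import mpoly.
From mathcomp Require Import ring zify.
From Stdlib Require Classical_Prop IndefiniteDescription.
Set Implicit Arguments. Unset Strict Implicit. Unset Printing Implicit Defensive.
Import Order.TTheory GRing.Theory.
Local Open Scope ring_scope.

(** * GCD domains *)

(** The rings K[x], K(x) and K[[x]] meet here, but nearly all computations stay in K[x]: left ideals
    of K(x)[d] are replaced by saturated left ideals of A, dimensions over K(x) by relations with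
    cleared denominators ([rank_le]), and divisibility in K[[x]] by congruences modulo a power of
    the maximal ideal at the origin ([flat]). Monomials are added until all of U_m is reached
    because this fixes the shape of M in advance: its head terms are exactly the exponents of degree
    m + 1. The bound |U_m| on the rank of L is d, coming from G, plus one for each added monomial
    x^u, since K(x)[d] modulo the operators x_i d_i - u_i is spanned by 1. In the other direction M
    belongs to the smaller ideal L, yet a reduction modulo L is also one modulo J. A linear form
    lambda on the fiber gives the series with coefficients lambda(d^u)/u!, by Taylor's formula. As J
    is stable under every d_i, it suffices that P f vanishes at the origin for all P in J. *)

Definition divides (R : idomainType) (a b : R) := exists c, b = c * a.

Definition gcd_spec (R : idomainType) (s : seq R) (g : R) :=
  (forall a, a \in s -> divides g a) /\
  (forall e, (forall a, a \in s -> divides e a) -> divides e g).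

Definition gcd_domain (R : idomainType) :=
  forall a b : R, exists g, gcd_spec [:: a; b] g.

Definition coprime_seq (R : idomainType) (s : seq R) :=
  forall e, (forall a, a \in s -> divides e a) -> divides e 1.

Section Divides.
Variable R : idomainType.
Implicit Types (a b c e g r : R) (s : seq R).

Lemma divides_refl a : divides a a.
Proof. by exists 1; rewrite mul1r. Qed.

Lemma divides_trans b a c : divides a b -> divides b c -> divides a c.
Proof. by case=> x -> [y ->]; exists (y * x); rewrite mulrA. Qed.

Lemma divides_mull a b c : divides a b -> divides a (c * b).
Proof. by case=> x ->; exists (c * x); rewrite mulrA. Qed.

Lemma divides_mulr a b c : divides a b -> divides a (b * c).
Proof. by rewrite mulrC; apply: divides_mull. Qed.

Lemma divides0 a : divides a 0.
Proof. by exists 0; rewrite mul0r. Qed.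

Lemma divides_add a b c : divides a b -> divides a c -> divides a (b + c).
Proof. by case=> x -> [y ->]; exists (x + y); rewrite mulrDl. Qed.

Lemma divides_opp a b : divides a b -> divides a (- b).
Proof. by case=> x ->; exists (- x); rewrite mulNr. Qed.

Lemma divides_sub a b c : divides a b -> divides a c -> divides a (b - c).
Proof. by move=> ? ?; apply/divides_add/divides_opp. Qed.

Lemma divides_mul2l c a b : c != 0 -> divides (c * a) (c * b) <-> divides a b.
Proof.
move=> c0; split=> [[x h]|[x ->]]; last by exists x; rewrite mulrCA.
by exists x; apply: (mulfI c0); rewrite h; ring.
Qed.

Lemma divides_mul_mono a b c e :
  divides a b -> divides c e -> divides (a * c) (b * e).
Proof. by case=> x -> [y ->]; exists (x * y); ring. Qed.

Lemma divides0P a : divides 0 a <-> a = 0.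
Proof. by split=> [[x ->]|->]; [rewrite mulr0|apply: divides0]. Qed.

End Divides.

Section GcdDomain.
Variable R : idomainType.
Implicit Types (a b c e g r : R) (s : seq R).
Hypothesis gcdR : gcd_domain R.

Lemma gcd_exists s : exists g, gcd_spec s g.
Proof.
elim: s => [|a s [g [h1 h2]]].
  by exists 0; split=> // e _; apply: divides0.
have [g' [h3 h4]] := gcdR a g; exists g'; split=> [b|e he].
  rewrite inE => /orP[/eqP->|bs]; first by apply: h3; rewrite mem_head.
  by apply: divides_trans (h1 _ bs); apply: h3; rewrite !inE eqxx orbT.
apply: h4 => b; rewrite !inE => /orP[/eqP->|/eqP->].
  by apply: he; rewrite mem_head.
by apply: h2 => c cs; apply: he; rewrite inE cs orbT.
Qed.

(** The gcd [h] of the multiples [a * x] is itself a multiple [h' * a]. Cancelling [a] shows that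
    [h'] divides every member of [s], hence [g], so [r] divides [h], which divides [a * g]. *)
Lemma gcd_mull s g a r : gcd_spec s g ->
  (forall x, x \in s -> divides r (a * x)) -> divides r (a * g).
Proof.
move=> [_ h2] hr; have [->|a0] := eqVneq a 0; first by rewrite mul0r; apply: divides0.
have [h [h3 h4]] := gcd_exists [seq a * x | x <- s].
have [h' hE] : divides a h.
  by apply: h4 => _ /mapP[x _ ->]; exists x; rewrite mulrC.
apply: (divides_trans (b := h)); first by apply: h4 => _ /mapP[x xs ->]; apply: hr.
rewrite hE mulrC; apply/divides_mul2l => //; apply: h2 => x xs.
apply/(divides_mul2l _ _ a0); rewrite [a * h']mulrC -hE.
by apply: h3; apply: map_f.
Qed.

Lemma coprime_mull s a r : coprime_seq s ->
  (forall x, x \in s -> divides r (a * x)) -> divides r a.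
Proof. by move=> cs hr; rewrite -[a]mulr1; apply: gcd_mull hr; split=> // x _; exists x; rewrite mulr1. Qed.

Lemma gauss_divides c a b : coprime_seq [:: c; a] -> divides c (a * b) -> divides c b.
Proof.
move=> cc h; apply: (coprime_mull cc) => x; rewrite !inE => /orP[/eqP->|/eqP->].
  exact/divides_mull/divides_refl.
by rewrite mulrC.
Qed.

Lemma lcm2_exists a b : exists l,
  [/\ divides a l, divides b l & forall q, divides a q -> divides b q -> divides l q].
Proof.
have [->|a0] := eqVneq a 0.
  exists 0; split; [exact: divides0|exact: divides0|by []].
have [g gs] := gcdR a b; have [h1 h2] := gs.
have [a' aE] := h1 a (mem_head _ _).
have [b' bE] : divides g b by apply: h1; rewrite !inE eqxx orbT.
have g0 : g != 0 by apply: contra_neq a0 => g0; rewrite aE g0 mulr0.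
exists (g * a' * b'); split.
- by rewrite {1}aE; exists b'; ring.
- by rewrite {1}bE; exists a'; ring.
- move=> q aq bq; apply/(divides_mul2l _ _ g0).
  (* After multiplication by [g] the claim reads: [a * b] divides [q * g]. By [gcd_mull] it is
     enough that it divides [q * a] and [q * b]. *)
  have -> : g * (g * a' * b') = a * b by rewrite aE bE; ring.
  rewrite [g * q]mulrC; apply: (gcd_mull gs) => x; rewrite !inE.
  case/orP=> /eqP->; last by apply: divides_mul_mono => //; apply: divides_refl.
  by rewrite mulrC [q * a]mulrC; rewrite [b * a]mulrC; apply: divides_mul_mono => //; apply: divides_refl.
Qed.

Lemma lcm_exists s : exists l, (forall a, a \in s -> divides a l) /\
  forall q, (forall a, a \in s -> divides a q) -> divides l q.
Proof.
elim: s => [|a s [l [h1 h2]]].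
  by exists 1; split=> // q _; exists q; rewrite mulr1.
have [l' [h3 h4 h5]] := lcm2_exists a l; exists l'; split=> [b|q hq].
  rewrite inE => /orP[/eqP->//|bs]; exact: divides_trans (h1 _ bs) h4.
apply: h5; first by apply: hq; rewrite mem_head.
by apply: h2 => b bs; apply: hq; rewrite inE bs orbT.
Qed.

End GcdDomain.

(** * Gauss' lemma *)

Section Gauss.
Variable R : idomainType.
Implicit Types (a b c : R).
Hypothesis gcdR : gcd_domain R.


Lemma divides_polyC a (p : {poly R}) : (forall i, divides a p`_i) <-> divides (a%:P : {poly R}) p.
Proof.
split=> [h|[q ->] i]; last by rewrite coefMC; apply/divides_mull/divides_refl.
have [f hf] : exists f : nat -> R, forall i, (i < size p)%N -> p`_i = f i * a.
  elim: (size p) => [|k [f hf]]; first by exists (fun=> 0).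
  have [y hy] := h k; exists (fun i => if i == k then y else f i) => i.
  by rewrite ltnS leq_eqVlt; case: eqP => [->|_ /= /hf].
exists (\poly_(i < size p) f i); apply/polyP=> i; rewrite coefMC coef_poly.
by case: ltnP => [/hf//|/leq_sizeP ->]; rewrite ?mul0r.
Qed.

Definition primitive_poly (p : {poly R}) := coprime_seq (polyseq p).

Lemma divides_primitive a (p : {poly R}) : primitive_poly p -> divides (a%:P : {poly R}) p -> divides a 1.
Proof.
by move=> pp /divides_polyC h; apply: pp => b /(nthP 0)[i _ <-].
Qed.

Lemma primitive_neq0 (p : {poly R}) : primitive_poly p -> p != 0.
Proof.
move=> pp; apply/eqP=> p0; have := divides_primitive (a := 0) pp.
rewrite p0 => /(_ (divides0 _)) /divides0P /eqP; by rewrite oner_eq0.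
Qed.

Lemma content_exists (p : {poly R}) : p != 0 ->
  exists c q, [/\ c != 0, p = c%:P * q & primitive_poly q].
Proof.
move=> p0; have [c cs] := gcd_exists gcdR p; have [h1 h2] := cs.
have /divides_polyC [q hq] : forall i, divides c p`_i.
  move=> i; have [hi|hi] := ltnP i (size p); first by apply: h1; apply: mem_nth.
  by rewrite nth_default //; apply: divides0.
have c0 : c != 0 by apply: contra_neq p0 => c0; rewrite hq c0 mulr0.
exists c, q; split=> //; first by rewrite mulrC.
move=> e he; apply/(divides_mul2l _ _ c0); rewrite mulr1; apply: h2 => x.
case/(nthP 0)=> i hi <-; rewrite hq coefMC mulrC.
apply: divides_mul_mono; last exact: divides_refl.
have [hi'|hi'] := ltnP i (size q); first by apply: he; apply: mem_nth.
by rewrite nth_default //; apply: divides0.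
Qed.

Lemma divides_content_mul e a (p : {poly R}) :
  primitive_poly p -> divides e%:P (a%:P * p) -> divides e a.
Proof.
move=> pp /divides_polyC h; apply: (coprime_mull gcdR pp) => x /(nthP 0)[i _ <-].
by have := h i; rewrite coefCM.
Qed.

Lemma divides_gcd_coprime c a : (forall d, divides d c -> divides d a -> divides d 1) ->
  coprime_seq [:: c; a].
Proof. by move=> h e he; apply: h; apply: he; rewrite !inE eqxx ?orbT. Qed.

Lemma primitive_polyP (p : {poly R}) :
  (forall a, divides (a%:P : {poly R}) p -> divides a 1) -> primitive_poly p.
Proof.
move=> h e he; apply/h/divides_polyC => i.
have [hi|hi] := ltnP i (size p); first by apply: he; apply: mem_nth.
by rewrite nth_default //; apply: divides0.
Qed.

Definition poly_tail (p : {poly R}) := p - lead_coef p *: 'X^((size p).-1).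

Lemma size_poly_tail p : p != 0 -> (size (poly_tail p) < size p)%N.
Proof.
move=> p0; have s0 : (0 < size p)%N by rewrite size_poly_gt0.
rewrite -[X in (_ < X)%N]prednK // ltnS; apply/leq_sizeP => j.
rewrite coefB coefZ coefXn leq_eqVlt => /orP[/eqP<-|hj].
  by rewrite eqxx mulr1 subrr.
rewrite gtn_eqF // mulr0 subr0 nth_default //.
by move: hj; rewrite prednK.
Qed.

(** A gcd domain need not have primes to reduce by, so Gauss' lemma is proved by induction on the
    sizes: a constant [c] dividing [p * q] is coprime to both leading coefficients, yet divides
    their product, and is therefore a unit. *)
Lemma primitive_poly_mul (p q : {poly R}) :
  primitive_poly p -> primitive_poly q -> primitive_poly (p * q).
Proof.
have [k] := ubnP (size p + size q)%N; elim: k p q => // k ih p q hk pp pq.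
(* a common divisor d of the coefficients of p q and of lead_coef p also divides (poly_tail p) q *)
have key (p1 q1 : {poly R}) c : (size p1 + size q1 < k.+1)%N -> primitive_poly p1 ->
    primitive_poly q1 -> divides c%:P (p1 * q1) ->
    coprime_seq [:: c; lead_coef p1].
  move=> hs pp1 pq1 hc; apply: divides_gcd_coprime => d dc da.
  have dl : divides d%:P (lead_coef p1 *: 'X^((size p1).-1)).
    by rewrite -mul_polyC; apply: divides_mulr; case: da => x ->; exists x%:P; rewrite polyCM.
  have p1E : p1 = poly_tail p1 + lead_coef p1 *: 'X^((size p1).-1) by rewrite subrK.
  have dt : divides d%:P (poly_tail p1 * q1).
    rewrite /poly_tail mulrBl; apply: divides_sub; last exact: divides_mulr.
    apply: divides_trans hc; case: dc => x ->; exists x%:P; by rewrite polyCM.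
  apply: (divides_primitive pp1); rewrite p1E; apply: divides_add => //.
  have [->|t0] := eqVneq (poly_tail p1) 0; first exact: divides0.
  (* The primitive part [r] of the tail is shorter than [p1], so [r * q1] is primitive by induction
     and [d] has to divide the content [g]. *)
  have [g [r [g0 rE pr]]] := content_exists t0.
  rewrite rE in dt *; apply: divides_mulr.
  rewrite -mulrA in dt; have prq : primitive_poly (r * q1).
    apply: ih => //; rewrite ltnS in hs; apply: leq_trans hs; rewrite -addSn leq_add2r.
    have := size_poly_tail (primitive_neq0 pp1).
    by rewrite rE mul_polyC size_scale.
  by have [y ->] := divides_content_mul prq dt; exists y%:P; rewrite polyCM.
apply: primitive_polyP => c hc.
have c1 := key p q c hk pp pq hc.
have c2 : coprime_seq [:: c; lead_coef q].
  by apply: (key q p) => //; [rewrite addnC|rewrite mulrC].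
have cb : divides c (lead_coef q).
  apply: (gauss_divides gcdR c1); rewrite -lead_coefM lead_coefE.
  by move/divides_polyC: hc; apply.
by apply: c2 => x; rewrite !inE => /orP[/eqP->|/eqP-> //]; apply: divides_refl.
Qed.

(** In [a%:P * f = h * r] split off the content [g] of [h]. What remains on the right is primitive
    by Gauss' lemma, so [a] divides [g] and can be cancelled. *)
Lemma primitive_divides (r f : {poly R}) a : primitive_poly r -> a != 0 ->
  divides r (a%:P * f) -> divides r f.
Proof.
move=> pr a0 [h hE]; have aP0 : a%:P != 0 :> {poly R} by rewrite polyC_eq0.
have [h0|h0] := eqVneq h 0.
  by move/eqP: hE; rewrite h0 mul0r mulf_eq0 (negPf aP0) => /eqP->; apply: divides0.
have [g [h' [g0 h'E ph']]] := content_exists h0.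
have [b gE] : divides a g.
  apply: (@divides_content_mul a g (h' * r)); first exact: primitive_poly_mul.
  by rewrite mulrA -h'E -hE; exists f; rewrite mulrC.
exists (b%:P * h'); apply: (mulfI aP0); rewrite hE h'E gE polyCM; ring.
Qed.

(** Polynomials over the fraction field form a principal ideal domain. Pseudo-division by an element
    of least size expresses this over [R], the factor [a] being a power of the leading coefficient
    of [r]. *)
Lemma min_ideal_poly (I : {poly R} -> Prop) :
  (forall p q, I p -> I q -> I (p - q)) -> (forall u p, I p -> I (u * p)) ->
  (exists2 p, I p & p != 0) ->
  exists r, [/\ I r, r != 0 & forall f, I f -> exists a, a != 0 /\ divides r ((a%:P : {poly R}) * f)].
Proof.
move=> IB IM ex; have Imin : exists r, [/\ I r, r != 0 &
    forall f, I f -> (size f < size r)%N -> f = 0].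
  case: ex => p Ip p0; have [k] := ubnP (size p); elim: k p Ip p0 => // k ih p Ip p0 hk.
  have [[f [If fs f0]]|none] := Classical_Prop.classic (exists f, [/\ I f, (size f < size p)%N & f != 0]).
    by apply: (ih f) => //; apply: leq_trans fs _.
  exists p; split=> // f If fs; apply/eqP; apply/negPn/negP=> f0.
  by apply: none; exists f.
case: Imin => r [Ir r0 rmin]; exists r; split=> // f If.
have E := Pdiv.Idomain.divp_eq f r.
exists (lead_coef r ^+ scalp f r); split; first by rewrite expf_neq0 // lead_coef_eq0.
exists (f %/ r)%R; rewrite mul_polyC E.
suff -> : (f %% r)%R = 0 by rewrite addr0.
apply: rmin; last by rewrite Pdiv.Idomain.ltn_modp.
have -> : (f %% r)%R = (lead_coef r ^+ scalp f r)%:P * f - (f %/ r)%R * r.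
  by rewrite mul_polyC E addrAC subrr add0r.
by apply: IB; apply: IM.
Qed.

(** The least element of the ideal of [f] and [g] is their gcd over the fraction field. Its
    primitive part, times the gcd of the two contents, is the gcd over [R]. *)
Lemma gcd_domain_poly : gcd_domain {poly R}.
Proof.
move=> f g.
have [->|f0] := eqVneq f 0.
  exists g; split=> [a|e he]; last by apply: he; rewrite !inE eqxx orbT.
  by rewrite !inE => /orP[/eqP->|/eqP->]; [apply: divides0|apply: divides_refl].
have [->|g0] := eqVneq g 0.
  exists f; split=> [a|e he]; last by apply: he; rewrite !inE eqxx.
  by rewrite !inE => /orP[/eqP->|/eqP->]; [apply: divides_refl|apply: divides0].
have [cf [f' [cf0 fE pf]]] := content_exists f0.
have [cg [g' [cg0 gE pg]]] := content_exists g0.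
have [|||r [[u [v rE]] r0 rdiv]] := @min_ideal_poly (fun p => exists u v, p = u * f + v * g).
- by move=> p q [u [v ->]] [u' [v' ->]]; exists (u - u'), (v - v'); ring.
- by move=> c p [u [v ->]]; exists (c * u), (c * v); ring.
- by exists f => //; exists 1, 0; ring.
have [cr [r' [cr0 rE' pr]]] := content_exists r0.
have r'r : divides r' r by rewrite rE'; apply/divides_mull/divides_refl.
have r'f : divides r' f.
  have [|a [a0 ra]] := rdiv f; first by exists 1, 0; ring.
  by apply: (primitive_divides pr a0); apply: divides_trans ra.
have r'g : divides r' g.
  have [|a [a0 ra]] := rdiv g; first by exists 0, 1; ring.
  by apply: (primitive_divides pr a0); apply: divides_trans ra.
have r'f' : divides r' f' by apply: (primitive_divides pr cf0); rewrite -fE.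
have r'g' : divides r' g' by apply: (primitive_divides pr cg0); rewrite -gE.
have [c [c1 c2]] := gcdR cf cg.
have cdf : divides c cf by apply: c1; rewrite !inE eqxx.
have cdg : divides c cg by apply: c1; rewrite !inE eqxx orbT.
have lift a b : divides a b -> divides a%:P b%:P by case=> x ->; exists x%:P; rewrite polyCM.
exists (c%:P * r'); split=> [a|e he].
  rewrite !inE => /orP[/eqP->|/eqP->]; [rewrite fE|rewrite gE];
    by apply: divides_mul_mono => //; apply: lift.
have ef : divides e f by apply: he; rewrite !inE eqxx.
have eg : divides e g by apply: he; rewrite !inE eqxx orbT.
have e0 : e != 0 by apply: contra_neq f0 => e0; case: ef => x ->; rewrite e0 mulr0.
have [ce [e' [ce0 eE pe]]] := content_exists e0.
have ce_e : divides ce%:P e by rewrite eE; apply/divides_mulr/divides_refl.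
have e'e : divides e' e by rewrite eE; apply/divides_mull/divides_refl.
rewrite eE; apply: divides_mul_mono.
  apply: lift; apply: c2 => x; rewrite !inE => /orP[/eqP->|/eqP->].
    by apply: (divides_content_mul pf); rewrite -fE; apply: divides_trans ef.
  by apply: (divides_content_mul pg); rewrite -gE; apply: divides_trans eg.
apply: (primitive_divides pe cr0); rewrite -rE' rE.
apply: divides_add; apply: divides_mull; first exact: divides_trans ef.
exact: divides_trans eg.
Qed.

End Gauss.

(** Up to constant factors one element [r] of the ideal divides all members of [s]. Hence [r]
    divides [K%:P * f] for a common constant [K] and all [f]; by coprimality it divides [K%:P], so
    it has degree zero. *)
Lemma ideal_const (R : idomainType) (s : seq {poly R}) :
  gcd_domain R -> uniq s -> coprime_seq s -> (exists2 f, f \in s & f != 0) ->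
  exists a : {poly R} -> {poly R}, exists r : R,
    r != 0 /\ \sum_(f <- s) a f * f = r%:P.
Proof.
move=> gcdR us cs [f1 f1s f10].
have [|||r [[a rE] r0 rdiv]] := @min_ideal_poly R
    (fun p => exists a : {poly R} -> {poly R}, \sum_(f <- s) a f * f = p).
- move=> p q [a <-] [b <-]; exists (fun f => a f - b f).
  by rewrite -sumrB; apply: eq_bigr => f _; rewrite mulrBl.
- move=> c p [a <-]; exists (fun f => c * a f).
  by rewrite mulr_sumr; apply: eq_bigr => f _; rewrite mulrA.
- exists f1 => //; exists (fun f => (f == f1)%:R).
  rewrite (bigD1_seq f1) ?us //= eqxx mul1r big1 ?addr0 //.
  by move=> i /negPf->; rewrite mul0r.
have sum_in f : f \in s -> exists a : {poly R} -> {poly R}, \sum_(f <- s) a f * f = f.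
  move=> fs; exists (fun g => (g == f)%:R).
  rewrite (bigD1_seq f) ?us //= eqxx mul1r big1 ?addr0 //.
  by move=> i /negPf->; rewrite mul0r.
have [K [K0 hK]] : exists K, K != 0 /\ forall f, f \in s -> divides r (K%:P * f).
  elim: (s) (fun f (h : f \in s) => rdiv f (sum_in f h)) => [|f t ih] h.
    by exists 1; rewrite oner_neq0.
  have [|K [K0 hK]] := ih; first by move=> g gt; apply: h; rewrite inE gt orbT.
  have [b [b0 hb]] := h f (mem_head _ _).
  exists (b * K); split; first by rewrite mulf_neq0.
  move=> g; rewrite inE polyCM => /orP[/eqP->|/hK hg].
    by rewrite mulrAC; apply: divides_mulr.
  by rewrite -mulrA; apply: divides_mull.
have [q qE] : divides r K%:P := coprime_mull (gcd_domain_poly gcdR) cs hK.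
have K0' : K%:P != 0 :> {poly R} by rewrite polyC_eq0.
have q0 : q != 0 by apply: contra_neq K0' => q0; rewrite qE q0 mul0r.
have : size r = 1%N.
  have := size_mul q0 r0; rewrite -qE size_polyC K0.
  have := q0; have := r0; rewrite -!size_poly_gt0.
  by case: (size r) (size q) => [|[|x]] [|[|y]] //=; rewrite ?addnS ?addSn.
case/eqP/size_poly1P=> c c0 rc; exists a, c; by rewrite rE rc.
Qed.

(** * Polynomials in several variables *)

Lemma mpoly_term_ind (R : nzRingType) (n : nat) (Q : {mpoly R[n]} -> Prop) :
  Q 0 -> (forall p q, Q p -> Q q -> Q (p + q)) -> (forall c u, Q (c *: 'X_[u])) ->
  forall p, Q p.
Proof. by move=> Q0 QD QX p; rewrite [p]mpolyE; elim/big_ind: _ => // u _. Qed.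

Lemma mpoly_rmorph_ext (R : nzRingType) (n : nat) (S : nzRingType)
    (f g : {rmorphism {mpoly R[n]} -> S}) :
  (forall c, f c%:MP = g c%:MP) -> (forall i, f 'X_i = g 'X_i) -> f =1 g.
Proof.
move=> hC hX; elim/mpoly_term_ind => [|p q hp hq|c u]; first by rewrite !rmorph0.
  by rewrite !rmorphD hp hq.
rewrite -mul_mpolyC !rmorphM hC; congr (_ * _).
by rewrite mpolyXE_id !rmorph_prod; apply: eq_bigr => i _; rewrite !rmorphXn hX.
Qed.

Lemma gcd_domain_can (R S : idomainType) (f : {rmorphism R -> S}) (g : {rmorphism S -> R}) :
  cancel f g -> cancel g f -> gcd_domain S -> gcd_domain R.
Proof.
move=> fK gK gcdS a b; have [h [h1 h2]] := gcdS (f a) (f b).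
have mapg x y : divides x y -> divides (g x) (g y) by case=> z ->; exists (g z); rewrite rmorphM.
have mapf x y : divides x y -> divides (f x) (f y) by case=> z ->; exists (f z); rewrite rmorphM.
exists (g h); split=> [x|e he].
  rewrite !inE => /orP[/eqP->|/eqP->]; [rewrite -(fK a)|rewrite -(fK b)];
    by apply: mapg; apply: h1; rewrite !inE eqxx ?orbT.
rewrite -(fK e); apply: mapg; apply: h2 => x; rewrite !inE => /orP[/eqP->|/eqP->];
  by apply: mapf; apply: he; rewrite !inE eqxx ?orbT.
Qed.

Lemma coprime_seq_can (R S : idomainType) (f : {rmorphism R -> S}) (g : {rmorphism S -> R}) s :
  cancel f g -> cancel g f -> coprime_seq s -> coprime_seq (map f s).
Proof.
move=> fK gK cs e he; have [|z hz] := cs (g e).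
  by move=> a /(map_f f)/he[z hz]; exists (g z); rewrite -rmorphM -hz fK.
by exists (f z); rewrite -(rmorph1 f) hz rmorphM gK.
Qed.

(** * Polynomials in n+1 variables as univariate polynomials in the variable i *)

Section Variable_i.
Variables (K : fieldType) (n : nat) (i : 'I_n.+1).

Definition to_poly_coef : {mpoly K[n.+1]} -> {poly {mpoly K[n]}} :=
  mmap (polyC \o @mpolyC n K)
    (fun j => if unlift i j is Some k then ('X_k)%:P else 'X).

Definition embed_coef : {mpoly K[n]} -> {mpoly K[n.+1]} :=
  mmap (@mpolyC n.+1 K) (fun k => 'X_(lift i k)).

HB.instance Definition _ := GRing.RMorphism.copy embed_coef embed_coef.
HB.instance Definition _ := GRing.RMorphism.copy to_poly_coef to_poly_coef.

Definition of_poly_coef (p : {poly {mpoly K[n]}}) : {mpoly K[n.+1]} :=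
  horner_eval 'X_i (map_poly embed_coef p).

HB.instance Definition _ := GRing.RMorphism.copy of_poly_coef
  (horner_eval ('X_i : {mpoly K[n.+1]}) \o map_poly embed_coef).

Lemma to_poly_coefK : cancel to_poly_coef of_poly_coef.
Proof.
move=> p; apply: (@mpoly_rmorph_ext _ _ _ (of_poly_coef \o to_poly_coef) idfun) => [c|j] /=.
  by rewrite /to_poly_coef mmapC /= /of_poly_coef map_polyC /= /horner_eval hornerC /embed_coef mmapC.
rewrite /to_poly_coef mmapX mmap1U; case: unliftP => [k ->|->].
  by rewrite /of_poly_coef map_polyC /= /horner_eval hornerC /embed_coef mmapX mmap1U.
by rewrite /of_poly_coef map_polyX /= /horner_eval hornerX.
Qed.

Lemma to_poly_coef_embed a : to_poly_coef (embed_coef a) = a%:P.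
Proof.
move: a; apply: (@mpoly_rmorph_ext _ _ _ (to_poly_coef \o embed_coef) polyC) => [c|j] /=.
  by rewrite /embed_coef mmapC /to_poly_coef mmapC.
by rewrite /embed_coef mmapX mmap1U /to_poly_coef mmapX mmap1U liftK.
Qed.

Lemma of_poly_coefK : cancel of_poly_coef to_poly_coef.
Proof.
move=> p; rewrite /of_poly_coef /horner_eval.
elim/poly_ind: p => [|p c ih]; first by rewrite rmorph0 horner0 rmorph0.
rewrite rmorphD rmorphM /= map_polyX map_polyC /= hornerMXaddC rmorphD rmorphM /=.
congr (_ + _); last exact: to_poly_coef_embed.
congr (_ * _); first exact: ih.
by rewrite /to_poly_coef mmapX mmap1U unlift_none.
Qed.

Lemma embed_coef_supp a u : (embed_coef a)@_u != 0 -> u i = 0%N.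
Proof.
elim/mpoly_term_ind: a => [|p q hp hq|c v].
- by rewrite rmorph0 mcoeff0 eqxx.
- have -> : embed_coef (p + q) = embed_coef p + embed_coef q by exact: rmorphD.
  rewrite mcoeffD => h; case: (eqVneq ((embed_coef p)@_u) 0) => [hp0|/hp//].
  by apply: hq; move: h; rewrite hp0 add0r.
rewrite /embed_coef mmapZ mmapX /mmap1 mul_mpolyC.
under eq_bigr => k _ do rewrite mpolyXn.
rewrite mprodXE mcoeffZ mcoeffX; case: (_ =P u) => [<- _|_]; last by rewrite mulr0 eqxx.
rewrite mnm_sumE big1 // => k _; rewrite mulmnE mnm1E.
by rewrite eq_sym (negPf (neq_lift _ _)).
Qed.
End Variable_i.

Lemma gcd_domain_mpoly (K : fieldType) n : gcd_domain {mpoly K[n]}.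
Proof.
elim: n => [|n ih]; last first.
  exact: (gcd_domain_can (@to_poly_coefK K n ord_max) (@of_poly_coefK K n ord_max) (gcd_domain_poly ih)).
have dv (a b : {mpoly K[0]}) : a != 0 -> divides a b.
  rewrite [a]nvar0_mpolyC [b]nvar0_mpolyC mpolyC_eq0 => a0.
  by exists (b@_0 / a@_0)%:MP; rewrite -mpolyCM mulfVK.
move=> a b; have [->|a0] := eqVneq a 0.
  exists b; split=> [x|e he]; last by apply: he; rewrite !inE eqxx orbT.
  by rewrite !inE => /orP[/eqP->|/eqP->]; [apply: divides0|apply: divides_refl].
exists a; split=> [x _|e he]; first exact: dv.
by apply: he; rewrite !inE eqxx.
Qed.

(** Common zeros of coprime polynomials have codimension at least two, so their projection along x_i
    does not fill the space. Algebraically, [ideal_const] is applied over the ring of the remaining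
    variables, whose constants are the polynomials free of x_i. *)
Lemma mpoly_elimination (K : fieldType) n (i : 'I_n) (s : seq {mpoly K[n]}) :
  uniq s -> coprime_seq s -> (exists2 f, f \in s & f != 0) ->
  exists a : {mpoly K[n]} -> {mpoly K[n]}, exists r : {mpoly K[n]},
    [/\ r != 0, (forall u, r@_u != 0 -> u i = 0%N) & \sum_(f <- s) a f * f = r].
Proof.
case: n i s => [[//]|n] i s us cs [f fs f0].
have fK := @to_poly_coefK K n i; have gK := @of_poly_coefK K n i.
have inj := can_inj fK.
have [||a [r [r0 rE]]] := ideal_const (@gcd_domain_mpoly K n) _ (coprime_seq_can fK gK cs).
- by rewrite map_inj_uniq.
- exists (to_poly_coef i f); first exact: map_f.
  by rewrite -(rmorph0 (to_poly_coef i)) (inj_eq inj).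
exists (fun g => of_poly_coef i (a (to_poly_coef i g))), (embed_coef i r); split.
- apply: contra_neq r0 => r0; apply: polyC_inj.
  by rewrite -(to_poly_coef_embed i) r0 !rmorph0.
- exact: embed_coef_supp.
rewrite -[RHS]fK to_poly_coef_embed -rE rmorph_sum big_map /=.
apply: eq_bigr => g _; transitivity (of_poly_coef i (a (to_poly_coef i g)) * of_poly_coef i (to_poly_coef i g)).
  by rewrite fK.
by apply: esym; apply: rmorphM.
Qed.

Lemma is_lcm_exists (K : fieldType) n (s : seq {mpoly K[n]}) : exists l, is_lcm s l.
Proof. exact: (lcm_exists (@gcd_domain_mpoly K n)). Qed.

(** * Operators and saturated left ideals *)

Section SupportSums.
Variables (R : nzRingType) (n : nat) (V : zmodType) (F : 'X_{1..n} -> R -> V).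
Hypothesis FD : forall u, {morph F u : a b / a + b}.
Implicit Types P Q : {mpoly R[n]}.

Let F0 u : F u 0 = 0.
Proof. by apply: (addrI (F u 0)); rewrite -FD !addr0. Qed.

(** All operations on operators and series are sums over [msupp], which is not additive because of
    cancellation. Summing over a common larger list instead makes additivity a termwise matter. *)
Lemma big_msupp_sub P (s : seq 'X_{1..n}) : uniq s -> {subset msupp P <= s} ->
  \sum_(u <- msupp P) F u P@_u = \sum_(u <- s) F u P@_u.
Proof.
move=> us sub; rewrite [RHS](bigID (mem (msupp P))) /= [X in _ = _ + X]big1 ?addr0.
  rewrite -[RHS]big_filter; apply: perm_big; apply: uniq_perm.
  - exact: msupp_uniq.
  - exact: filter_uniq.
  by move=> u; rewrite mem_filter andb_idr // => /sub.
by move=> u /memN_msupp_eq0 ->; apply: F0.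
Qed.

Lemma big_msuppD P Q : \sum_(u <- msupp (P + Q)) F u (P + Q)@_u =
  \sum_(u <- msupp P) F u P@_u + \sum_(u <- msupp Q) F u Q@_u.
Proof.
pose s := undup (msupp (P + Q) ++ msupp P ++ msupp Q).
have sub (T : {mpoly R[n]}) : T \in [:: P + Q; P; Q] -> {subset msupp T <= s}.
  by rewrite !inE => /or3P[] /eqP-> u hu; rewrite mem_undup !mem_cat hu ?orbT.
rewrite !(@big_msupp_sub _ s) ?undup_uniq //; try by apply: sub; rewrite !inE eqxx ?orbT.
by rewrite -big_split; apply: eq_bigr => u _; rewrite mcoeffD FD.
Qed.

Lemma big_msupp0 : \sum_(u <- msupp (0 : {mpoly R[n]})) F u (0 : {mpoly R[n]})@_u = 0.
Proof. by rewrite msupp0 big_nil. Qed.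

Lemma big_msupp_term c v :
  \sum_(u <- msupp (c *: 'X_[v] : {mpoly R[n]})) F u (c *: 'X_[v] : {mpoly R[n]})@_u = F v c.
Proof.
rewrite (@big_msupp_sub _ [:: v]) //.
  by rewrite big_seq1 mcoeffZ mcoeffX eqxx mulr1.
by move=> u /msuppZ_le; rewrite msuppX.
Qed.
End SupportSums.

Section Operators.
Variables (K : fieldType) (n : nat).
Implicit Types (c : {mpoly K[n]}) (P Q g : {mpoly {mpoly K[n]}[n]}) (i j : 'I_n)
  (u v : 'X_{1..n}).

Lemma dleft_morph_aux i u : {morph (fun c : {mpoly K[n]} =>
  c *: 'X_[(u + U_(i))%MM] + c^`M(i) *: 'X_[u] : {mpoly {mpoly K[n]}[n]}) : a b / a + b}.
Proof. by move=> a b; rewrite mderivD !scalerDl addrACA. Qed.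

Lemma dleftD i : {morph (@dleft K n i) : P Q / P + Q}.
Proof. by move=> P Q; rewrite /dleft (big_msuppD (dleft_morph_aux i)). Qed.

Lemma dleft0 i : dleft i (0 : {mpoly {mpoly K[n]}[n]}) = 0.
Proof. by apply: (addrI (dleft i 0)); rewrite -dleftD !addr0. Qed.

Lemma dleft_sum i (I : Type) (s : seq I) (p : pred I) (F : I -> {mpoly {mpoly K[n]}[n]}) :
  dleft i (\sum_(x <- s | p x) F x) = \sum_(x <- s | p x) dleft i (F x).
Proof. exact: (big_morph (dleft i) (dleftD i) (dleft0 i)). Qed.

Lemma dleft_term i c u : dleft i (c *: 'X_[u]) =
  c *: 'X_[(u + U_(i))%MM] + c^`M(i) *: 'X_[u].
Proof. exact: (big_msupp_term (dleft_morph_aux i)). Qed.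

Lemma dleftZ i c P : dleft i (c *: P) = c *: dleft i P + c^`M(i) *: P.
Proof.
elim/mpoly_term_ind: P => [|P Q hP hQ|b u]; first by rewrite !(scaler0, dleft0) addr0.
  by rewrite scalerDr !dleftD hP hQ !scalerDr addrACA.
rewrite scalerA !dleft_term scalerDr !scalerA mderivM scalerDl.
by rewrite [c^`M(i) * b *: _ + _]addrC addrA.
Qed.

Lemma dleftN i P : dleft i (- P) = - dleft i P.
Proof. by apply: (addrI (dleft i P)); rewrite -dleftD !subrr dleft0. Qed.

Lemma dleftB i P Q : dleft i (P - Q) = dleft i P - dleft i Q.
Proof. by rewrite dleftD dleftN. Qed.

Lemma dleftC i j P : dleft i (dleft j P) = dleft j (dleft i P).
Proof.
elim/mpoly_term_ind: P => [|P Q hP hQ|b u]; first by rewrite !dleft0.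
  by rewrite [dleft j _]dleftD [dleft i (P + Q)]dleftD !dleftD; apply: congr2.
rewrite !dleft_term !dleftD !dleft_term mderiv_comm addrACA.
by rewrite -!addmA [(U_(i) + U_(j))%MM]addmC.
Qed.

Lemma dleft_iterC i j k P : iter k (dleft j) (dleft i P) = dleft i (iter k (dleft j) P).
Proof. by elim: k => [//|k ih]; rewrite !iterS ih; apply: dleftC. Qed.

(** [dmon] applies the derivations in a fixed order; as they commute, the additional one can be
    moved to the outside. *)
Lemma dmonDU i u P : dmon (u + U_(i))%MM P = dleft i (dmon u P).
Proof.
rewrite /dmon; have : i \in enum 'I_n by rewrite mem_enum.
elim: (enum 'I_n) (enum_uniq 'I_n) => //= j s ih /andP[js us].
have -> : (u + U_(i))%MM j = (u j + (i == j))%N by rewrite mnmDE mnm1E.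
rewrite inE; case: eqP => [-> _|ij /=].
  rewrite addn1 iterS; congr (dleft j (iter _ _ _)).
  elim: s js {ih us} => //= k s ih; rewrite inE negb_or => /andP[jk js].
  by rewrite mnmDE mnm1E (negPf jk) addn0 ih.
by move=> si; rewrite addn0 ih // dleft_iterC.
Qed.

Lemma opmul_morph_aux g u :
  {morph (fun c : {mpoly K[n]} => c *: dmon u g) : a b / a + b}.
Proof. by move=> a b; rewrite scalerDl. Qed.

Lemma opmulDl g : {morph (fun P => opmul P g) : P Q / P + Q}.
Proof. by move=> P Q; rewrite /opmul (big_msuppD (opmul_morph_aux g)). Qed.

Lemma opmul0l g : opmul 0 g = 0.
Proof. exact: (big_msupp0 (fun u c => c *: dmon u g)). Qed.

Lemma opmul_terml g c u : opmul (c *: 'X_[u]) g = c *: dmon u g.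
Proof. exact: (big_msupp_term (opmul_morph_aux g)). Qed.

Lemma opmulZl g c P : opmul (c *: P) g = c *: opmul P g.
Proof.
elim/mpoly_term_ind: P => [|P Q hP hQ|b u]; first by rewrite scaler0 opmul0l scaler0.
  by rewrite scalerDr !opmulDl hP hQ scalerDr.
by rewrite scalerA !opmul_terml scalerA.
Qed.

Lemma opmul_dleft g i P : opmul (dleft i P) g = dleft i (opmul P g).
Proof.
elim/mpoly_term_ind: P => [|P Q hP hQ|b u]; first by rewrite dleft0 opmul0l dleft0.
  by rewrite dleftD !opmulDl dleftD; apply: congr2.
by rewrite dleft_term opmulDl !opmul_terml dleftZ dmonDU.
Qed.

Lemma dmon0 P : dmon 0%MM P = P.
Proof. by rewrite /dmon; elim: (enum 'I_n) => //= j s ->; rewrite mnm0E. Qed.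

Lemma opmul1l g : opmul 1 g = g.
Proof. by rewrite -mpolyX0 -[X in opmul X]scale1r opmul_terml scale1r dmon0. Qed.

Definition left_ideal (L : {mpoly {mpoly K[n]}[n]} -> Prop) :=
  [/\ L 0, forall P Q, L P -> L Q -> L (P + Q), forall c P, L P -> L (c *: P) &
      forall i P, L P -> L (dleft i P)].

(** The saturated left ideals of K[x][d] are exactly the intersections of K[x][d] with left ideals
    of K(x)[d]; in this form ideals of K(x)[d] are handled throughout. *)
Definition saturated (L : {mpoly {mpoly K[n]}[n]} -> Prop) :=
  forall c P, c != 0 -> L (c *: P) -> L P.

Implicit Types L : {mpoly {mpoly K[n]}[n]} -> Prop.

Lemma left_idealN L P : left_ideal L -> L P -> L (- P).
Proof. by case=> _ _ hZ _ h; rewrite -scaleN1r; apply: hZ. Qed.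

Lemma left_idealB L P Q : left_ideal L -> L P -> L Q -> L (P - Q).
Proof. by move=> hL hP hQ; case: (hL) => _ hD _ _; apply: hD => //; apply: left_idealN. Qed.

Lemma left_ideal_sum L (I : Type) (s : seq I) (p : pred I) F : left_ideal L ->
  (forall x, p x -> L (F x)) -> L (\sum_(x <- s | p x) F x).
Proof. by case=> h0 hD _ _ h; elim/big_ind: _. Qed.

Lemma left_ideal_opmul L P Q : left_ideal L -> L Q -> L (opmul P Q).
Proof.
move=> hL hQ; case: (hL) => h0 hD hZ hd; apply: left_ideal_sum => // u _; apply: hZ.
rewrite /dmon; elim: (enum 'I_n) => //= j s ih; elim: (u j) => //= k; exact: hd.
Qed.

Section Generated.
Variable G : seq {mpoly {mpoly K[n]}[n]}.

Lemma in_lideal_left_ideal : left_ideal (in_lideal G).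
Proof.
split.
- exists (nseq (size G) 0); split; first by rewrite size_nseq.
  rewrite big1 // => k _; rewrite nth_nseq if_same. exact: opmul0l.
- move=> _ _ [rs [sr ->]] [ts [st ->]].
  exists (mkseq (fun k => nth 0 rs k + nth 0 ts k) (size G)); split; first by rewrite size_mkseq.
  by rewrite -big_split; apply: eq_bigr => k _; rewrite nth_mkseq // opmulDl.
- move=> c _ [rs [sr ->]]; exists [seq c *: r | r <- rs]; split; first by rewrite size_map.
  rewrite scaler_sumr; apply: eq_bigr => k _.
  by rewrite (nth_map 0) ?sr // opmulZl.
- move=> i _ [rs [sr ->]]; exists [seq dleft i r | r <- rs]; split; first by rewrite size_map.
  rewrite dleft_sum; apply: eq_bigr => k _.
  by rewrite (nth_map 0) ?sr // opmul_dleft.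
Qed.

Lemma mem_in_lideal g : g \in G -> in_lideal G g.
Proof.
move=> gG; have gi : (index g G < size G)%N by rewrite index_mem.
exists (mkseq (fun k => (k == index g G)%:R) (size G)); split; first by rewrite size_mkseq.
rewrite (bigD1 (Ordinal gi)) //= nth_mkseq // eqxx opmul1l nth_index // big1 ?addr0 // => k.
by rewrite -val_eqE /= => /negPf kg; rewrite nth_mkseq // kg opmul0l.
Qed.

Lemma in_rlideal_left_ideal : left_ideal (in_rlideal G).
Proof.
have [h0 hD hZ hd] := in_lideal_left_ideal; split.
- by exists 1; rewrite oner_neq0 scaler0.
- move=> P Q [a [a0 ha]] [b [b0 hb]]; exists (a * b); split; first by rewrite mulf_neq0.
  rewrite scalerDr; apply: hD; last by rewrite -scalerA; apply: hZ.
  by rewrite mulrC -scalerA; apply: hZ.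
- move=> c P [a [a0 ha]]; exists a; split=> //.
  by rewrite scalerA mulrC -scalerA; apply: hZ.
(* The denominator is squared as in the quotient rule: a^2 d_i P = a d_i (a P) - (d_i a) (a P). *)
- move=> i P [a [a0 ha]]; exists (a * a); split; first by rewrite mulf_neq0.
  have -> : a * a *: dleft i P = a *: dleft i (a *: P) - a^`M(i) *: (a *: P).
    by rewrite dleftZ scalerDr !scalerA [a^`M(i) * a]mulrC addrK.
  by apply: (left_idealB in_lideal_left_ideal); apply: hZ => //; apply: hd.
Qed.

Lemma in_rlideal_saturated : saturated (in_rlideal G).
Proof.
move=> c P c0 [a [a0 h]]; exists (a * c); split; first by rewrite mulf_neq0.
by rewrite -scalerA.
Qed.

Lemma mem_in_rlideal g : g \in G -> in_rlideal G g.
Proof. by move=> h; exists 1; rewrite oner_neq0 scale1r; split=> //; apply: mem_in_lideal. Qed.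

(** This is applied to annihilators of power series: a solution of the generators is then a solution
    of the whole ideal. *)
Lemma in_rlideal_min L : left_ideal L -> saturated L -> (forall g, g \in G -> L g) ->
  forall P, in_rlideal G P -> L P.
Proof.
move=> hL sL hG P [c [c0 [rs [sr cP]]]]; apply: (sL c) => //; rewrite cP.
apply: left_ideal_sum => // k _; apply: left_ideal_opmul => //.
by apply: hG; apply: mem_nth.
Qed.
End Generated.
End Operators.

(** * Graded term orders and reduction *)

Section TermOrder.
Variables (n : nat) (lt : rel 'X_{1..n}).
Hypothesis hlt : graded_term_order lt.
Implicit Types u v w t : 'X_{1..n}.

Definition lte u v := (u == v) || lt u v.

Lemma lt_irr u : lt u u = false.
Proof. by case: hlt => h _ _ _ _; apply: h. Qed.

Lemma lt_trans_to u v w : lt u v -> lt v w -> lt u w.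
Proof. by case: hlt => _ h _ _ _; apply: h. Qed.

Lemma term_total u v : lte u v || lt v u.
Proof.
rewrite /lte; have [//|uv] := eqVneq u v.
by case: hlt => _ _ h _ _; apply: h.
Qed.

Lemma term_lt_asym u v : lt u v -> lt v u -> False.
Proof. by move=> h /(lt_trans_to h); rewrite lt_irr. Qed.

Lemma lt_add2r u v w : lt u v -> lt (u + w)%MM (v + w)%MM.
Proof. by case: hlt => _ _ _ h _; apply: h. Qed.

Lemma mdeg_lt u v : (mdeg u < mdeg v)%N -> lt u v.
Proof. by case: hlt => _ _ _ _; apply. Qed.

Lemma lt_mdeg u v : lt u v -> (mdeg u <= mdeg v)%N.
Proof. by move=> h; rewrite leqNgt; apply/negP=> /mdeg_lt/(term_lt_asym h). Qed.

Lemma lte_mdeg u v : lte u v -> (mdeg u <= mdeg v)%N.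
Proof. by case/orP=> [/eqP->//|]; apply: lt_mdeg. Qed.

Lemma lte_lt_trans u v w : lte u v -> lt v w -> lt u w.
Proof. by case/orP=> [/eqP->//|]; apply: lt_trans_to. Qed.

Lemma lt_lte_trans u v w : lt u v -> lte v w -> lt u w.
Proof. by move=> uv /orP[/eqP<-//|]; apply: lt_trans_to. Qed.

Lemma lte_trans u v w : lte u v -> lte v w -> lte u w.
Proof. by move=> uv /orP[/eqP<-//|] /(lte_lt_trans uv) h; apply/orP; right. Qed.

Lemma lte_add2r u v w : lte u v -> lte (u + w)%MM (v + w)%MM.
Proof. by case/orP=> [/eqP->|/lt_add2r h]; apply/orP; [left|right]. Qed.

Lemma lte_refl u : lte u u.
Proof. by rewrite /lte eqxx. Qed.

Lemma lem_lte u v : (u <= v)%MM -> lte u v.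
Proof.
move=> h; rewrite /lte; have [//|uv] := eqVneq u v; apply: mdeg_lt.
rewrite -(submK h) mdegD -[X in (X < _)%N]add0n ltn_add2r lt0n mdeg_eq0.
by apply: contra_neq uv => e; rewrite -[v](submK h) e add0m.
Qed.

Definition exps_upto N := map (@bmnm n N.+1) (enum {: 'X_{1..n < N.+1}}).

Lemma mem_exps_upto N v : (v \in exps_upto N) = (mdeg v <= N)%N.
Proof.
apply/mapP/idP=> [[w _ ->]|h]; first by rewrite -ltnS bmdeg.
by have h' : (mdeg v < N.+1)%N by []; exists (BMultinom h'); rewrite ?mem_enum.
Qed.

Lemma uniq_exps_upto N : uniq (exps_upto N).
Proof. by rewrite map_inj_uniq ?enum_uniq //; apply: val_inj. Qed.

(** Exponents below [u] have at most the degree of [u] because the order is graded. So there are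
    finitely many, and their number measures [u] for well-founded induction. *)
Definition lt_height u := size [seq w <- exps_upto (mdeg u) | lt w u].

Lemma lt_height_lt u v : lt u v -> (lt_height u < lt_height v)%N.
Proof.
move=> uv; rewrite /lt_height.
have -> : (size [seq w <- exps_upto (mdeg u) | lt w u]).+1 =
  size (u :: [seq w <- exps_upto (mdeg u) | lt w u]) by [].
apply: uniq_leq_size; first by rewrite /= mem_filter lt_irr filter_uniq // uniq_exps_upto.
move=> w; rewrite inE !mem_filter !mem_exps_upto => /orP[/eqP->|/andP[wu h]].
  by rewrite uv lt_mdeg.
by rewrite (lt_trans_to wu uv) (leq_trans h (lt_mdeg uv)).
Qed.

Lemma lt_ind (Q : 'X_{1..n} -> Prop) :
  (forall u, (forall v, lt v u -> Q v) -> Q u) -> forall u, Q u.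
Proof.
move=> h u; have [k] := ubnP (lt_height u); elim: k u => // k ih u hu; apply: h => v vu.
by apply: ih; apply: leq_trans (lt_height_lt vu) _.
Qed.

Lemma lt_min_exists (Q : 'X_{1..n} -> Prop) : (exists u, Q u) ->
  exists2 u, Q u & forall v, Q v -> lte u v.
Proof.
case=> u; elim/lt_ind: u => u ih Qu.
have [[v [vu Qv]]|none] := Classical_Prop.classic (exists v, lt v u /\ Q v); first exact: (ih v).
exists u => // v Qv; have /orP[//|vu] := term_total u v.
by case: none; exists v.
Qed.

Lemma lt_max_seq (s : seq 'X_{1..n}) : s != [::] ->
  exists2 t, t \in s & forall u, u \in s -> lte u t.
Proof.
elim: s => // u s ih _; have [->|/ih[t ts ht]] := eqVneq s [::].
  by exists u; rewrite ?mem_head // => v; rewrite inE => /eqP->; apply: lte_refl.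
have /orP[ut|tu] := term_total u t.
  by exists t => [|v]; rewrite inE ?ts ?orbT // => /orP[/eqP->//|/ht].
exists u; rewrite ?mem_head // => v; rewrite inE => /orP[/eqP->|/ht vt]; first exact: lte_refl.
by apply: lte_trans vt _; apply/orP; right.
Qed.

Lemma mnm_ind (Q : 'X_{1..n} -> Prop) : Q 0%MM -> (forall u i, Q u -> Q (u + U_(i))%MM) ->
  forall u, Q u.
Proof.
move=> Q0 QS u; have [k] := ubnP (mdeg u); elim: k u => // k ih u hu.
have [->//|] := eqVneq u 0%MM; rewrite -mdeg_eq0 mdegE => u0.
have [i ui] : exists i, u i != 0%N.
  apply/existsP; apply: contraNT u0 => /existsPn h; rewrite big1 // => i _.
  by apply/eqP; have := h i; rewrite negbK.
have le : (U_(i) <= u)%MM by rewrite lep1mP.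
rewrite -(submK le); apply/QS/ih; rewrite ltnS in hu; apply: leq_trans hu.
by rewrite -{2}(submK le) mdegD mdeg1 addn1.
Qed.

Section HeadTerm.
Variables (R : nzRingType).
Implicit Types P : {mpoly R[n]}.

Lemma hterm_spec P : P != 0 -> P@_(hterm lt P) != 0 /\ forall u, P@_u != 0 -> lte u (hterm lt P).
Proof.
move=> P0; rewrite /hterm; set t := foldr _ _ _.
have [ht mt] : t \in 0%MM :: msupp P /\ forall u, u \in 0%MM :: msupp P -> lte u t.
  rewrite /t; elim: (msupp P) => /= [|a s [h1 h2]].
    by rewrite inE eqxx; split=> // u; rewrite inE => /eqP->; apply: lte_refl.
  set b := foldr _ _ s in h1 h2 *; have /orP[ab|ba] := term_total a b.
    have -> : (if lt a b then b else a) = b.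
      by case/orP: ab => [/eqP->|->//]; rewrite if_same.
    split=> [|u]; first by move: h1; rewrite !inE => /orP[->//|->]; rewrite !orbT.
    rewrite !inE => /or3P[/eqP->|/eqP->//|us]; first by apply: h2; rewrite mem_head.
    by apply: h2; rewrite inE us orbT.
  rewrite ifN; last by apply/negP=> /term_lt_asym/(_ ba).
  split=> [|u]; first by rewrite !inE eqxx orbT.
  rewrite !inE => /or3P[/eqP->|/eqP->|us]; last 1 first.
  - by apply: (@lte_trans _ b); [apply: h2; rewrite inE us orbT|apply/orP; right].
  - apply: (@lte_trans _ b); [by apply: h2; rewrite mem_head|by apply/orP; right].
  exact: lte_refl.
have mt' u : P@_u != 0 -> lte u t.
  by rewrite -mcoeff_msupp => h; apply: mt; rewrite inE h orbT.
split=> //; move: ht; rewrite inE mcoeff_msupp => /orP[/eqP t0|//].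
(* The fold may have returned its default value 0. Then every exponent of the support has degree at
   most 0, so 0 does belong to the nonempty support. *)
case E: (msupp P) => [|u s]; first by rewrite (msuppnil0 E) eqxx in P0.
have us : P@_u != 0 by rewrite -mcoeff_msupp E mem_head.
by move/lte_mdeg: (mt' u us); rewrite t0 mdeg0 leqn0 mdeg_eq0 => /eqP <-.
Qed.

Lemma hterm_eq P t : P@_t != 0 -> (forall u, P@_u != 0 -> lte u t) -> hterm lt P = t.
Proof.
move=> Pt ht; have P0 : P != 0 by apply: contra_neq Pt => ->; rewrite mcoeff0.
have [h1 h2] := hterm_spec P0.
have /orP[/eqP//|l1] := ht _ h1; have /orP[/eqP//|l2] := h2 _ Pt.
by case: (term_lt_asym l1 l2).
Qed.
End HeadTerm.

(** * Reduction of operators with denominators in a prescribed multiplicative set *)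

Section Reduction.
Variable (K : fieldType).
Implicit Types (c : {mpoly K[n]}) (P Q g : {mpoly {mpoly K[n]}[n]}).

Lemma mcoeff_dleft i P w : (dleft i P)@_w = (P * 'X_i)@_w + (P@_w)^`M(i).
Proof.
elim/mpoly_term_ind: P => [|P Q hP hQ|c u]; first by rewrite dleft0 mul0r !mcoeff0 mderiv0 addr0.
  rewrite dleftD (mulrDl P Q) [LHS]mcoeffD; apply: etrans (congr2 +%R hP hQ) _.
  rewrite (mcoeffD w (P * _)) (mcoeffD w P) (mderivD i P@_w); exact: addrACA.
rewrite dleft_term [LHS]mcoeffD -scalerAl -mpolyXD; congr (_ + _).
rewrite [LHS]mcoeffZ [(c *: _)@_w]mcoeffZ !mcoeffX; case: (u == w).
  by rewrite !mulr1.
by rewrite !mulr0 mderiv0.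
Qed.

(** Differentiating a coefficient leaves its exponent at most [hterm lt P], which is strictly below
    the new head term; hence the head coefficient is unchanged. *)
Lemma hterm_dleft i P : P != 0 -> dleft i P != 0 /\
  (hterm lt (dleft i P) = hterm lt P + U_(i))%MM /\ hcoeff lt (dleft i P) = hcoeff lt P.
Proof.
move=> /hterm_spec[h1 h2]; set t := hterm lt P in h1 h2 *.
have ltt : lt t (t + U_(i))%MM by apply: mdeg_lt; rewrite mdegD mdeg1 addn1.
have E : (dleft i P)@_(t + U_(i)) = P@_t.
  rewrite mcoeff_dleft {1}addmC mcoeffMX; have [->|/h2 h] := eqVneq P@_(t + U_(i)) 0.
    by rewrite mderiv0 addr0.
  by have := lte_lt_trans h ltt; rewrite lt_irr.
have H : hterm lt (dleft i P) = (t + U_(i))%MM.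
  apply: hterm_eq => [|w]; first by rewrite E.
  rewrite mcoeff_dleft => hw; have [Pw|/h2 wt] := eqVneq P@_w 0; last first.
    by apply/orP; right; apply: lte_lt_trans wt ltt.
  rewrite Pw mderiv0 addr0 -mcoeff_msupp (perm_mem (msuppMX _ _)) in hw.
  case/mapP: hw => k; rewrite mcoeff_msupp => /h2 hk ->.
  by rewrite addmC; apply: lte_add2r.
by split; [apply: contra_neq h1 => e; rewrite -E e mcoeff0|rewrite /hcoeff H E].
Qed.

Lemma left_ideal_shift (L : {mpoly {mpoly K[n]}[n]} -> Prop) g v : left_ideal L -> L g -> g != 0 ->
  exists Q, [/\ L Q, Q != 0, hterm lt Q = (hterm lt g + v)%MM & hcoeff lt Q = hcoeff lt g].
Proof.
move=> [_ _ _ hd] Lg g0; elim/mnm_ind: v => [|v i [Q [LQ Q0 Q1 Q2]]].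
  by exists g; rewrite addm0.
have [d0 [d1 d2]] := hterm_dleft i Q0.
by exists (dleft i Q); split; rewrite ?d1 ?d2 ?Q1 ?addmA //; apply: hd.
Qed.

(** [Z] is a multiplicative set of allowed denominators containing the head coefficients. Nonzero
    polynomials give normal forms over K(x), and polynomials with nonzero value at the origin give
    them over the local ring K[x]_(0). *)
Lemma reduction (L : {mpoly {mpoly K[n]}[n]} -> Prop) (G : seq {mpoly {mpoly K[n]}[n]})
    (Z : {mpoly K[n]} -> Prop) :
  left_ideal L -> (forall g, g \in G -> g != 0 /\ L g) ->
  Z 1 -> (forall a b, Z a -> Z b -> Z (a * b)) -> (forall g, g \in G -> Z (hcoeff lt g)) ->
  forall P, exists c Q, [/\ Z c, L (c *: P - Q) & forall u, Q@_u != 0 -> parametric lt G u].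
Proof.
move=> hL hG Z1 ZM ZG P; have [L0 LD LZ Ld] := hL.
have key t : forall P, (forall u, P@_u != 0 -> lte u t) ->
    exists c Q, [/\ Z c, L (c *: P - Q) & forall u, Q@_u != 0 -> parametric lt G u].
  elim/lt_ind: t => t ih {}P hP.
  have step P' : (forall u, P'@_u != 0 -> lt u t) ->
      exists c Q, [/\ Z c, L (c *: P' - Q) & forall u, Q@_u != 0 -> parametric lt G u].
    move=> hP'; have [->|/hterm_spec[h1 h2]] := eqVneq P' 0.
      by exists 1, 0; split=> //; [rewrite scaler0 subr0|move=> u; rewrite mcoeff0 eqxx].
    by apply: (ih (hterm lt P')) => //; apply: hP'.
  have [pt|] := boolP (parametric lt G t).
    have [|c [Q [Zc LQ hQ]]] := step (P - P@_t *: 'X_[t]).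
      move=> u; rewrite mcoeffB mcoeffZ mcoeffX; have [->|tu] := eqVneq t u.
        by rewrite mulr1 subrr eqxx.
      by rewrite mulr0 subr0 => /hP /orP[/eqP e|//]; rewrite e eqxx in tu.
    exists c, (Q + (c * P@_t) *: 'X_[t]); split=> //.
      have -> : c *: P - (Q + (c * P@_t) *: 'X_[t]) = c *: (P - P@_t *: 'X_[t]) - Q.
        by rewrite scalerBr scalerA opprD [- Q + _]addrC addrA.
      by [].
    move=> u; have [->//|tu] := eqVneq u t.
    by rewrite mcoeffD mcoeffZ mcoeffX [t == u]eq_sym (negPf tu) mulr0 addr0; apply: hQ.
  rewrite /parametric negbK => /hasP[g gG gt]; have [g0 Lg] := hG g gG.
  have [Q0 [LQ0 Q00 Q1 Q2]] := left_ideal_shift (t - hterm lt g)%MM hL Lg g0.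
  rewrite addmC submK // in Q1; have [h1 h2] := hterm_spec Q00; rewrite Q1 in h2.
  have [|c [Q [Zc LQ hQ]]] := step (hcoeff lt g *: P - P@_t *: Q0).
    move=> u; rewrite mcoeffB !mcoeffZ; have [->|ut] := eqVneq u t.
      by rewrite -Q2 /hcoeff Q1 mulrC subrr eqxx.
    have [->|/hP Pu _] := eqVneq P@_u 0; last by case/orP: Pu => // /eqP e; rewrite e eqxx in ut.
    have [->|/h2 Qu _] := eqVneq Q0@_u 0; first by rewrite !mulr0 subrr eqxx.
    by case/orP: Qu => // /eqP e; rewrite e eqxx in ut.
  exists (c * hcoeff lt g), Q; split=> //; first by apply: ZM => //; apply: ZG.
  have -> : (c * hcoeff lt g) *: P - Q =
      (c *: (hcoeff lt g *: P - P@_t *: Q0) - Q) + (c * P@_t) *: Q0.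
    by rewrite scalerBr !scalerA addrAC subrK.
  by apply: LD => //; apply: LZ.
have [->|/hterm_spec[_ h]] := eqVneq P 0; last exact: (key _ P h).
by exists 1, 0; split=> //; [rewrite scaler0 subr0|move=> u; rewrite mcoeff0 eqxx].
Qed.
End Reduction.
End TermOrder.

(** * Ranks over the field of rational functions, without denominators *)

Lemma fraction_numden (R : idomainType) (z : {fraction R}) :
  exists d m : R, d != 0 /\ tofrac d * z = tofrac m.
Proof.
elim/quotW: z => r; exists \d_r, \n_r; split; first exact: denom_ratioP.
rewrite !piE; apply/eqmodP => /=; rewrite FracField.equivfE /FracField.mulf.
by rewrite !numden_Ratio ?mul1r ?mulr1 ?oner_neq0 ?denom_ratioP // mulrC.
Qed.

(** Counting dimensions gives a kernel vector over the fraction field; multiplying it by the product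
    of the denominators of all entries brings it back to [R]. *)
Lemma left_kernel_wide (R : idomainType) (l k : nat) (A : 'M[R]_(l, k)) :
  (k < l)%N -> exists2 x : 'rV[R]_l, x != 0 & x *m A = 0.
Proof.
move=> kl; pose A' := map_mx (@tofrac R) A.
have /rowV0Pn[y yk y0] : kermx A' != 0.
  rewrite -mxrank_eq0 mxrank_ker subn_eq0 -ltnNge.
  exact: leq_ltn_trans (rank_leq_col _) kl.
have [d hd] := fin_all_exists (fun j => fraction_numden (y 0 j)).
have [m hm] := fin_all_exists hd.
pose D := \prod_j d j; have D0 : D != 0 by apply/prodf_neq0 => j _; case: (hm j).
pose x : 'rV_l := \row_j (m j * \prod_(i | i != j) d i).
have xE : map_mx (@tofrac R) x = tofrac D *: y.
  apply/rowP => j; rewrite /x !mxE; have -> : D = d j * \prod_(i | i != j) d i by rewrite /D (bigD1 j).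
  rewrite !tofracM.
  by case: (hm j) => _ <-; rewrite mulrAC.
exists x.
  apply: contra_neq y0 => x0; move: xE; rewrite x0 map_mx0 => /esym/eqP.
  by rewrite scaler_eq0 tofrac_eq0 (negPf D0) => /eqP.
have inj : injective (map_mx (@tofrac R) : 'M_(1, k) -> 'M_(1, k)).
  move=> u v /matrixP h; apply/matrixP => a b; have := h a b; rewrite !mxE => /eqP.
  by rewrite tofrac_eq => /eqP.
apply: inj; rewrite map_mxM xE -scalemxAl map_mx0.
by move/sub_kermxP: yk => ->; rewrite scaler0.
Qed.

Section Rank.
Variables (K : fieldType) (n : nat).
Implicit Types (c : {mpoly K[n]}) (P Q : {mpoly {mpoly K[n]}[n]})
  (L : {mpoly {mpoly K[n]}[n]} -> Prop).

(** For a saturated left ideal [L] this bounds the dimension of K(x)[d] modulo K(x) L by [k]. Row j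
    of [M] plays the role of the coordinates of [C j *: P j], and only their relations are kept, so
    an embedding of the quotient into K(x)^k is enough. *)
Definition rank_le L (k : nat) := forall l (P : 'I_l -> {mpoly {mpoly K[n]}[n]}),
  exists (C : 'I_l -> {mpoly K[n]}) (M : 'M[{mpoly K[n]}]_(l, k)),
    (forall j, C j != 0) /\
    forall x : 'rV_l, x *m M = 0 -> L (\sum_j (x 0 j * C j) *: P j).

Lemma rank_le_ext L L' k : (forall P, L P <-> L' P) -> rank_le L k -> rank_le L' k.
Proof.
by move=> LL h l P; have [C [M [C0 hM]]] := h l P; exists C, M; split=> // x /hM/LL.
Qed.

(** The quotient by an intersection embeds into the sum of the two quotients, hence the juxtaposed
    matrices. The diagonal factors make both blocks refer to the same multiple [C1 j * C2 j] of
    [P j]. *)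
Lemma rank_le_inter L1 L2 k1 k2 : rank_le L1 k1 -> rank_le L2 k2 ->
  rank_le (fun P => L1 P /\ L2 P) (k1 + k2).
Proof.
move=> h1 h2 l P; have [C1 [M1 [C10 hM1]]] := h1 l P; have [C2 [M2 [C20 hM2]]] := h2 l P.
exists (fun j => C1 j * C2 j).
exists (row_mx (diag_mx (\row_j C2 j) *m M1) (diag_mx (\row_j C1 j) *m M2)).
split=> [j|x]; first by rewrite mulf_neq0.
rewrite mul_mx_row -(row_mx0 _ _ k1 k2) => /eq_row_mx; rewrite !mulmxA => -[e1 e2].
have dE (C : 'I_l -> {mpoly K[n]}) j : (x *m diag_mx (\row_j C j)) 0 j = x 0 j * C j.
  by rewrite mul_mx_diag !mxE.
split.
  have := hM1 _ e1; congr L1; apply: eq_bigr => j _.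
  by rewrite dE -mulrA [C2 j * _]mulrC.
have := hM2 _ e2; congr L2; apply: eq_bigr => j _.
by rewrite dE mulrA.
Qed.

Lemma rank_le_dependent L k l (P : 'I_l -> {mpoly {mpoly K[n]}[n]}) :
  rank_le L k -> (k < l)%N ->
  exists x : 'I_l -> {mpoly K[n]}, (exists j, x j != 0) /\ L (\sum_j x j *: P j).
Proof.
move=> h kl; have [C [M [C0 hM]]] := h l P; have [x x0 xM] := left_kernel_wide M kl.
exists (fun j => x 0 j * C j); split; last exact: hM.
by have /rV0Pn[j xj] := x0; exists j; rewrite mulf_neq0.
Qed.

Lemma rank_le_spanned L k (Q : 'I_k -> {mpoly {mpoly K[n]}[n]}) : left_ideal L ->
  (forall P, exists c (a : 'I_k -> {mpoly K[n]}), c != 0 /\ L (c *: P - \sum_i a i *: Q i)) ->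
  rank_le L k.
Proof.
move=> hL h l P; have [C hC] := fin_all_exists (fun j => h (P j)).
have [a ha] := fin_all_exists hC; exists C, (\matrix_(j, i) a j i).
split=> [j|x xM]; first by case: (ha j).
have -> : \sum_j (x 0 j * C j) *: P j =
    \sum_j x 0 j *: (C j *: P j - \sum_i a j i *: Q i).
  under [RHS]eq_bigr => j _ do rewrite scalerBr scalerA scaler_sumr.
  rewrite sumrB [X in _ - X]exchange_big /= [X in _ - X]big1 ?subr0 // => i _.
  under eq_bigr => j _ do rewrite scalerA.
  rewrite -scaler_suml; have /rowP/(_ i) := xM; rewrite !mxE => e.
  by under eq_bigr => j _ do rewrite -[a j i](mxE matrix_key (fun j i => a j i)) //; rewrite e scale0r.
apply: left_ideal_sum => // j _; case: hL => _ _ hZ _; apply: hZ; by case: (ha j).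
Qed.

Lemma mpoly_sum_nth (R : nzRingType) (p : {mpoly R[n]}) (s : seq 'X_{1..n}) :
  uniq s -> (forall u, p@_u != 0 -> u \in s) ->
  p = \sum_(i < size s) p@_(nth 0%MM s i) *: 'X_[nth 0%MM s i].
Proof.
move=> us hs; rewrite [LHS]mpolyE (@big_msupp_sub _ _ _ (fun u a => a *: 'X_[u]) _ p s) //.
- by rewrite (big_nth 0%MM) big_mkord.
- by move=> u a b; rewrite scalerDl.
- by move=> u; rewrite mcoeff_msupp; apply: hs.
Qed.

Lemma rank_le_GB (lt : rel 'X_{1..n}) L G d :
  graded_term_order lt -> left_ideal L -> is_GB lt L G -> is_rank lt G d -> rank_le L d.
Proof.
move=> hlt hL [hG hGB] [s [us sP <-]].
apply: (@rank_le_spanned L (size s) (fun i => 'X_[nth 0%MM s i])) => // P.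
have [|||c [Q [c0 LQ hQ]]] := reduction hlt (Z := fun c => c != 0) hL hG _ _ _ P.
- exact: oner_neq0.
- by move=> a b; apply: mulf_neq0.
- by move=> g /hG[g0 _]; case: (hterm_spec hlt g0).
exists c, (fun i => Q@_(nth 0%MM s i)); split=> //.
by rewrite -mpoly_sum_nth // => u /hQ; rewrite sP.
Qed.

Lemma GB_free (lt : rel 'X_{1..n}) L G P :
  graded_term_order lt -> is_GB lt L G -> L P ->
  (forall u, P@_u != 0 -> parametric lt G u) -> P = 0.
Proof.
move=> hlt [_ hGB] LP hP; apply/eqP; apply: contraT => P0.
have [g gG gP] := hGB P P0 LP; have [/hP/hasPn/(_ g gG)] := hterm_spec hlt P0.
by rewrite gP.
Qed.

(** Here W, V, D stand for d^(v+e_i), d^v, d_i, and primes for derivatives by x_i. From b V = a and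
    X D = k modulo L, with the derivative of the first relation, W is solved for. Operators are only
    added and multiplied by coefficients on the left, so a commutative identity is legitimate. *)
Lemma euler_identity (R : comNzRingType) (X a a' b b' : R) (k : nat) (W V D : {mpoly R[n]}) :
  (X * b * b) *: W - (b * (k%:R * a + X * a') - X * b' * a) *: 1 =
  (X * b) *: (b *: W + b' *: V - (a *: D + a' *: 1)) - (X * b') *: (b *: V - a *: 1)
    + (b * a) *: (X *: D - k%:R).
Proof. by rewrite -!mul_mpolyC; ring. Qed.

(* x_i d_i = u_i modulo L makes every d^v proportional to 1 over K(x) *)
Lemma rank_le_euler_ops L (u : 'X_{1..n}) : left_ideal L ->
  (forall i, L (euler_op K u i)) -> rank_le L 1.
Proof.
move=> hL Le; have [L0 LD LZ Ld] := hL.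
have key P : exists c (a : {mpoly K[n]}), c != 0 /\ L (c *: P - a *: 1).
  elim/mpoly_term_ind: P => [|P Q [c [a [c0 h]]] [c' [a' [c0' h']]]|c v].
  - by exists 1, 0; rewrite oner_neq0 !scaler0 scale0r subr0.
  - exists (c * c'), (c' * a + c * a'); split; first by rewrite mulf_neq0.
    have -> : (c * c') *: (P + Q) - (c' * a + c * a') *: 1 =
        c' *: (c *: P - a *: 1) + c *: (c' *: Q - a' *: 1).
      by rewrite !scalerBr !scalerA scalerDr scalerDl opprD addrACA [c' * c]mulrC.
    by apply: LD; apply: LZ.
  suff [b [a [b0 h]]] : exists b (a : {mpoly K[n]}), b != 0 /\ L (b *: 'X_[v] - a *: 1).
    exists b, (c * a); split; first exact: b0.
    have -> : b *: (c *: 'X_[v]) - (c * a) *: 1 = c *: (b *: 'X_[v] - a *: 1).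
      by rewrite scalerBr !scalerA mulrC.
    exact: LZ.
  elim/mnm_ind: v => [|v i [b [a [b0 h]]]].
    by exists 1, 1; rewrite oner_neq0 mpolyX0 subrr.
  have X0 : 'X_i != 0 :> {mpoly K[n]} by rewrite -msize_poly_eq0 msizeX.
  exists ('X_i * b * b), (b * ((u i)%:R * a + 'X_i * a^`M(i)) - 'X_i * b^`M(i) * a).
  split; first by rewrite !mulf_neq0.
  rewrite (euler_identity _ _ _ _ _ _ _ 'X_[v] 'X_[U_(i)]).
  have -> : b *: 'X_[(v + U_(i))] + b^`M(i) *: 'X_[v] - (a *: 'X_[U_(i)] + a^`M(i) *: 1) =
      dleft i (b *: 'X_[v] - a *: 1).
    by rewrite dleftB -[in RHS]mpolyX0 !dleft_term add0m mpolyX0.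
  apply: LD; last by apply: LZ; apply: Le.
  by apply: (left_idealB hL); apply: LZ; [apply: Ld|].
apply: (@rank_le_spanned L 1 (fun=> 1)) => // P.
by have [c [a h]] := key P; exists c, (fun=> a); rewrite big_ord1.
Qed.

Lemma rank_le_euler (u : 'X_{1..n}) : rank_le (in_rlideal (euler_ops K u)) 1.
Proof.
apply: (rank_le_euler_ops (u := u)); first exact: in_rlideal_left_ideal.
by move=> i; apply: mem_in_rlideal; apply: map_f; rewrite mem_enum.
Qed.

Lemma rank_le_inter_seq L k (T : seq 'X_{1..n}) : rank_le L k ->
  rank_le (fun P => L P /\ forall u, u \in T -> in_rlideal (euler_ops K u) P) (k + size T).
Proof.
move=> hk; elim: T => [|u T ih].
  by rewrite addn0; apply: rank_le_ext hk => P; split=> [|[]].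
rewrite /= addnS -addn1; apply: rank_le_ext (rank_le_inter ih (rank_le_euler u)) => P.
split=> [[[h1 h2] h3]|[h1 h2]].
  by split=> // v; rewrite inE => /orP[/eqP->|/h2].
split; last by apply: h2; rewrite mem_head.
by split=> // v vT; apply: h2; rewrite inE vT orbT.
Qed.
End Rank.

(** * Action on formal power series *)

Section PowerSeries.
Variables (K : fieldType) (n : nat).
Implicit Types (a b c : {mpoly K[n]}) (P Q : {mpoly {mpoly K[n]}[n]}) (f g h : fps K n)
  (u v w : 'X_{1..n}).

Let pmul_fun g w v (x : K) : K := if (v <= w)%MM then x * g (w - v)%MM else 0.

Let pmul_funD g w v : {morph pmul_fun g w v : x y / x + y}.
Proof. by move=> x y; rewrite /pmul_fun; case: ifP; rewrite ?mulrDl ?addr0. Qed.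

Let pmulE a g w : fps_pmul a g w = \sum_(v <- msupp a) pmul_fun g w v a@_v.
Proof. by rewrite /fps_pmul big_mkcond. Qed.

Lemma fps_pmulDl g w : {morph (fun a => fps_pmul a g w) : a b / a + b}.
Proof. by move=> a b; rewrite !pmulE (big_msuppD (pmul_funD g w)). Qed.

Lemma fps_pmul0l g w : fps_pmul 0 g w = 0.
Proof. by rewrite pmulE msupp0 big_nil. Qed.

Lemma fps_pmul_term k v g w : fps_pmul (k *: 'X_[v]) g w =
  if (v <= w)%MM then k * g (w - v)%MM else 0.
Proof. by rewrite pmulE (big_msupp_term (pmul_funD g w)). Qed.

Lemma eq_fps_pmul a g h w : g =1 h -> fps_pmul a g w = fps_pmul a h w.
Proof. by move=> gh; apply: eq_bigr => v _; rewrite gh. Qed.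

Lemma fps_pmulDr a g h w :
  fps_pmul a (fun w => g w + h w) w = fps_pmul a g w + fps_pmul a h w.
Proof. by rewrite -big_split; apply: eq_bigr => v _; rewrite mulrDr. Qed.

Lemma fps_pmul0r a w : fps_pmul a (fun=> 0) w = 0.
Proof. by apply: big1 => v _; rewrite mulr0. Qed.

Lemma fps_pmulA a b g w : fps_pmul (a * b) g w = fps_pmul a (fps_pmul b g) w.
Proof.
elim/mpoly_term_ind: a => [|a a' ha ha'|k v]; first by rewrite mul0r !fps_pmul0l.
  by rewrite mulrDl !fps_pmulDl ha ha'.
rewrite fps_pmul_term; elim/mpoly_term_ind: b => [|b b' hb hb'|l v'].
- by rewrite mulr0 !fps_pmul0l mulr0 if_same.
- by rewrite mulrDr !fps_pmulDl hb hb'; case: ifP; rewrite ?mulrDr ?addr0.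
rewrite -scalerAl -scalerAr scalerA -mpolyXD !fps_pmul_term.
have [vw|vw] := boolP (v <= w)%MM.
  have -> : (v + v' <= w)%MM = (v' <= w - v)%MM.
    apply/mnm_lepP/mnm_lepP => e i; have := e i; have := mnm_lepP vw i;
    rewrite !(mnmBE, mnmDE); lia.
  by rewrite submDA; case: ifP; rewrite ?mulrA ?mulr0.
rewrite ifN //; apply: contraNN vw; apply: lepm_trans; exact: lem_addr.
Qed.

Lemma mcoeffM_pmul a b w : (a * b)@_w = fps_pmul a (fun v => b@_v) w.
Proof.
elim/mpoly_term_ind: a => [|a a' ha ha'|k v]; first by rewrite mul0r mcoeff0 fps_pmul0l.
  by rewrite mulrDl fps_pmulDl mcoeffD ha ha'.
rewrite -scalerAl mcoeffZ fps_pmul_term mulrC; case: ifPn => [vw|vw].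
  by rewrite mulrC; congr (_ * _); rewrite mulrC -{1}(submK vw) addmC mcoeffMX.
suff -> : ('X_[v] * b)@_w = 0 by rewrite mul0r.
apply/eqP; rewrite mcoeff_eq0 mulrC (perm_mem (msuppMX _ _)).
by apply: contraNN vw => /mapP[m _ ->]; apply: lem_addr.
Qed.

Lemma fps_derDU i u f w :
  fps_der (u + U_(i))%MM f w = (w i).+1%:R * fps_der u f (w + U_(i))%MM.
Proof.
rewrite /fps_der mulrA -natrM.
have -> : (w + (u + U_(i)) = w + U_(i) + u)%MM by rewrite [(u + _)%MM]addmC addmA.
congr (_%:R * _); rewrite (bigD1 i) //= [in RHS](bigD1 i) //= mulnA; congr (_ * _)%N.
  rewrite !mnmDE !mnm1E eqxx !addn1 ffactnSr mulnC; congr (_ * _)%N; first by lia.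
  by rewrite addnS addSn.
by apply: eq_bigr => j ji; rewrite !mnmDE !mnm1E eq_sym (negPf ji) !addn0.
Qed.

(** This is the product rule, as [(w i).+1%:R * g (w + U_(i))%MM] is the coefficient of x^w in the
    i-th derivative of [g]. It makes [op_apply] compatible with [dleft]. *)
Lemma fps_pmul_leibniz i a g w :
  fps_pmul a (fun w => (w i).+1%:R * g (w + U_(i))%MM) w + fps_pmul a^`M(i) g w =
  (w i).+1%:R * fps_pmul a g (w + U_(i))%MM.
Proof.
elim/mpoly_term_ind: a => [|a a' ha ha'|k v].
- by rewrite mderiv0 !fps_pmul0l mulr0 addr0.
- by rewrite mderivD !fps_pmulDl mulrDr -ha -ha' addrACA.
rewrite mderivZ mderivX scalerA !fps_pmul_term.
have vU : (v <= w + U_(i))%MM = (v - U_(i) <= w)%MM.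
  apply/mnm_lepP/mnm_lepP => e j; have := e j;
  rewrite !(mnmBE, mnmDE) mnm1E; lia.
rewrite vU; have [le|nle] := boolP (v - U_(i) <= w)%MM; last first.
  rewrite ifN ?mulr0 ?addr0 //; apply: contraNN nle => h; apply: lepm_trans h; exact: lem_subr.
(* If [v i] is 0, the truncated difference [v - U_(i)] is [v] itself, and the derivative of x^v
   vanishes. *)
have [vi0|vi] := eqVneq (v i) 0%N.
  have v0 : (v - U_(i) = v)%MM.
    by apply/mnmP => j; rewrite mnmBE mnm1E; case: eqP => [<-|_]; rewrite ?vi0 ?subn0.
  rewrite v0 in le; rewrite le vi0 mulr0 mul0r addr0.
  have -> : (w - v + U_(i) = w + U_(i) - v)%MM.
    by apply/mnmP=> j; rewrite !(mnmBE, mnmDE) addnBAC //; apply/mnm_lepP.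
  by rewrite mnmBE vi0 subn0 mulrCA.
have leU : (U_(i) <= v)%MM by rewrite lep1mP.
have -> : (w - (v - U_(i)) = w + U_(i) - v)%MM by rewrite submBA.
case: ifPn => [vw|nvw].
  have -> : (w - v + U_(i) = w + U_(i) - v)%MM.
    by apply/mnmP=> j; rewrite !(mnmBE, mnmDE) addnBAC //; apply/mnm_lepP.
  rewrite !mulrA -mulrDl; congr (_ * _); rewrite -mulrDr mulrC; congr (_ * _).
  by rewrite -natrD mnmBE addSn subnK //; apply/mnm_lepP.
(* Only the derivative of x^v contributes: [v - U_(i)] is below [w] but [v] is not, which forces
   [v i = (w i).+1]. *)
rewrite add0r mulrA; congr (_ * _); rewrite mulrC; congr (_%:R * _).
apply/eqP; rewrite eqn_leq; apply/andP; split.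
  by have := mnm_lepP le i; rewrite mnmBE mnm1E eqxx leq_subLR add1n.
rewrite ltnNge; apply: contraNN nvw => h; apply/mnm_lepP => j.
have := mnm_lepP le j; rewrite mnmBE mnm1E; case: eqP => [<- _|_]; first by [].
by rewrite subn0.
Qed.

Let op_fun f w u c : K := fps_pmul c (fps_der u f) w.

Let op_funD f w u : {morph op_fun f w u : a b / a + b}.
Proof. exact: fps_pmulDl. Qed.

Lemma op_applyD f w : {morph (fun P => op_apply P f w) : P Q / P + Q}.
Proof. by move=> P Q; rewrite /op_apply (big_msuppD (op_funD f w)). Qed.

Lemma op_apply0 f w : op_apply 0 f w = 0.
Proof. by rewrite /op_apply msupp0 big_nil. Qed.

Lemma op_apply_term c u f w : op_apply (c *: 'X_[u]) f w = fps_pmul c (fps_der u f) w.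
Proof. exact: (big_msupp_term (op_funD f w)). Qed.

Lemma op_applyZ c P f w : op_apply (c *: P) f w = fps_pmul c (op_apply P f) w.
Proof.
elim/mpoly_term_ind: P => [|P Q hP hQ|b u].
- rewrite scaler0 op_apply0 (eq_fps_pmul _ _ (fun w => op_apply0 f w)).
  by rewrite fps_pmul0r.
- rewrite scalerDr op_applyD hP hQ -fps_pmulDr; apply: eq_fps_pmul => z.
  by rewrite op_applyD.
rewrite scalerA op_apply_term fps_pmulA; apply: eq_fps_pmul => z.
by rewrite op_apply_term.
Qed.

Lemma op_apply_dleft i P f w :
  op_apply (dleft i P) f w = (w i).+1%:R * op_apply P f (w + U_(i))%MM.
Proof.
elim/mpoly_term_ind: P => [|P Q hP hQ|c u]; first by rewrite dleft0 !op_apply0 mulr0.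
  rewrite dleftD op_applyD; apply: etrans (congr2 +%R hP hQ) _.
  by rewrite [op_apply (P + Q) _ _]op_applyD mulrDr.
rewrite dleft_term op_applyD !op_apply_term -fps_pmul_leibniz; congr (_ + _).
by apply: eq_fps_pmul => z; rewrite fps_derDU.
Qed.

Lemma op_applyN P f w : op_apply (- P) f w = - op_apply P f w.
Proof. by apply: (addrI (op_apply P f w)); rewrite -op_applyD !subrr op_apply0. Qed.

Definition annihilator f P := forall w, op_apply P f w = 0.

Lemma annihilator_left_ideal f : left_ideal (annihilator f).
Proof.
split=> [w|P Q hP hQ w|c P hP w|i P hP w].
- exact: op_apply0.
- by rewrite op_applyD hP hQ addr0.
- by rewrite op_applyZ (eq_fps_pmul _ _ hP) fps_pmul0r.
- by rewrite op_apply_dleft hP mulr0.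
Qed.

Definition mfact u : nat := (\prod_(i < n) (u i)`!)%N.

Lemma fps_der_at0 u f : fps_der u f 0%MM = (mfact u)%:R * f u.
Proof.
rewrite /fps_der add0m; congr (_%:R * _); apply: eq_bigr => i _.
by rewrite mnm0E add0n ffactnn.
Qed.

Section Order.
Variable lt : rel 'X_{1..n}.
Hypothesis hlt : graded_term_order lt.
Local Notation lte := (lte lt).

Lemma lte_add_eq u v w z : (u + v = w + z)%MM -> lte u w -> lte v z -> u = w.
Proof.
move=> e uw vz; case/orP: uw => [/eqP//|uw].
have := lt_add2r hlt v uw; rewrite e => h.
have := lte_add2r hlt w vz; rewrite addmC [(z + w)%MM]addmC => h'.
by have := lt_lte_trans hlt h h'; rewrite (lt_irr hlt).
Qed.

(** By [lte_add_eq] only one pair of exponents contributes. As [u] and [v] are mere lower bounds,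
    both coefficients may be zero; this allows [u] to be 0. *)
Lemma fps_pmul_lowest c g u v : (forall w, c@_w != 0 -> lte u w) ->
  (forall w, g w != 0 -> lte v w) -> fps_pmul c g (u + v)%MM = c@_u * g v.
Proof.
move=> hc hg; rewrite /fps_pmul.
rewrite (eq_bigr (fun w => if w == u then c@_u * g v else 0)); last first.
  move=> w wu; case: eqP => [->|/eqP ne]; first by rewrite [(u + v)%MM]addmC addmK.
  have [->|cw] := eqVneq c@_w 0; first by rewrite mul0r.
  have [->|gw] := eqVneq (g (u + v - w)%MM) 0; first by rewrite mulr0.
  have e : (u + v = w + (u + v - w))%MM by rewrite addmC [RHS]addmC submK // addmC.
  by rewrite (lte_add_eq e (hc _ cw) (hg _ gw)) eqxx in ne.
have [cu|cu] := eqVneq c@_u 0.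
  by rewrite cu mul0r big1 // => w _; rewrite if_same.
rewrite (big_rem u) ?mcoeff_msupp //= lem_addr eqxx big_seq_cond big1 ?addr0 // => w.
by rewrite mem_rem_uniq ?msupp_uniq // inE; case: eqP.
Qed.

Lemma mpoly_lowest c : c != 0 -> exists2 u, c@_u != 0 & forall w, c@_w != 0 -> lte u w.
Proof.
by move=> /(hterm_spec hlt)[h _]; apply: (lt_min_exists hlt); exists (hterm lt c).
Qed.

Lemma fps_pmul_eq0 c g : c != 0 -> (forall w, fps_pmul c g w = 0) -> forall w, g w = 0.
Proof.
move=> /mpoly_lowest[u cu hu] hcg w; apply/eqP; apply: contraT => gw.
have [v gv hv] := lt_min_exists hlt (ex_intro (fun w => g w != 0) w gw).
have := hcg (u + v)%MM; rewrite (fps_pmul_lowest hu hv) => /eqP.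
by rewrite mulf_eq0 (negPf cu) (negPf gv).
Qed.

Lemma annihilator_saturated f : saturated (annihilator f).
Proof.
move=> c P c0 h; apply: (fps_pmul_eq0 c0) => w; rewrite -op_applyZ; exact: h.
Qed.

Lemma sol_in_rlideal G f P : is_fps_sol G f -> in_rlideal G P -> annihilator f P.
Proof.
move=> hf; apply: in_rlideal_min; [exact: annihilator_left_ideal|exact: annihilator_saturated|].
exact: hf.
Qed.
End Order.

Definition monomial_fps u : fps K n := fun w => (w == u)%:R.

Lemma fps_der0 f w : fps_der 0%MM f w = f w.
Proof. by rewrite /fps_der addm0 big1 ?mul1r // => i _; rewrite mnm0E ffactn0. Qed.

Lemma op_apply_euler u i f w :
  op_apply (euler_op K u i) f w = ((w i)%:R - (u i)%:R) * f w.
Proof.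
have k1 : ((u i)%:R : {mpoly {mpoly K[n]}[n]}) = ((u i)%:R *: 'X_[0] : {mpoly K[n]}) *: 'X_[0].
  by rewrite !mpolyX0 !scaler_nat.
have k2 : 'X_i = 1 *: 'X_[U_(i)] :> {mpoly K[n]} by rewrite scale1r.
rewrite /euler_op op_applyD op_applyN k1 {1}k2 !op_apply_term !fps_pmul_term.
have -> : (0 <= w)%MM by apply/mnm_lepP => j; rewrite mnm0E.
rewrite subm0 fps_der0 mulrBl; congr (_ - _); rewrite lep1mP mul1r.
have [->|wi] := eqVneq (w i) 0%N; first by rewrite mul0r.
have le : (U_(i) <= w)%MM by rewrite lep1mP.
rewrite -[X in fps_der X _ _]add0m fps_derDU submK // fps_der0 mnmBE mnm1E eqxx.
by congr (_%:R * _); lia.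
Qed.

Lemma monomial_fps_sol u : is_fps_sol (euler_ops K u) (monomial_fps u).
Proof.
move=> g /mapP[i _ ->] w; rewrite op_apply_euler /monomial_fps.
by case: eqP => [->|_]; rewrite ?subrr ?mul0r ?mulr0.
Qed.

(** With P the ideal contains every d^w P, and the value of d^w P f at the origin is w! times the
    coefficient of x^w in P f. In characteristic zero all coefficients are thus recovered. *)
Lemma annihilator_at0 f (L : {mpoly {mpoly K[n]}[n]} -> Prop) : [pchar K] =i pred0 ->
  left_ideal L -> (forall P, L P -> op_apply P f 0%MM = 0) -> forall P, L P -> annihilator f P.
Proof.
move=> charK [_ _ _ hd] h0 P LP w; elim/mnm_ind: w P LP => [|w i ih] P LP; first exact: h0.
have := ih _ (hd i P LP); rewrite op_apply_dleft => /eqP; rewrite mulf_eq0.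
by rewrite (pcharf0P K).1 //= => /eqP.
Qed.

Lemma op_apply_at0 P f : op_apply P f 0%MM =
  \sum_(u <- msupp P) (P@_u)@_0%MM * ((mfact u)%:R * f u).
Proof.
apply: eq_bigr => u _; rewrite -fps_der_at0.
elim/mpoly_term_ind: (P@_u) => [|a b ha hb|k v].
- by rewrite fps_pmul0l mcoeff0 mul0r.
- by rewrite fps_pmulDl mcoeffD mulrDl ha hb.
rewrite fps_pmul_term mcoeffZ mcoeffX; have -> : (v <= 0)%MM = (v == 0%MM).
  apply/idP/eqP => [h|->]; last exact: lepm_refl.
  by apply/mnmP => i; apply/eqP; rewrite mnm0E -leqn0 -(mnm0E i); apply/mnm_lepP.
by case: eqP => [->|_]; rewrite ?mulr1 ?subm0 // mulr0 mul0r.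
Qed.
End PowerSeries.

(** * Indicial polynomials *)

Section Indicial.
Variables (K : fieldType) (n : nat) (lt : rel 'X_{1..n}).
Hypothesis hlt : graded_term_order lt.
Implicit Types (P : {mpoly {mpoly K[n]}[n]}) (f : fps K n) (a b u v w z : 'X_{1..n}).
Local Notation lte := (lte lt).

Lemma big_seq_fibers (I J : eqType) (V : nmodType) (p : I -> J) (r : seq I) (F : I -> V) :
  \sum_(x <- r) F x = \sum_(y <- undup (map p r)) \sum_(x <- r | p x == y) F x.
Proof.
under [RHS]eq_bigr => y _ do rewrite big_mkcond.
rewrite exchange_big /=; rewrite big_seq [RHS]big_seq; apply: eq_bigr => x xr.
rewrite (bigD1_seq (p x)) ?mem_undup ?undup_uniq ?map_f //= eqxx big1 ?addr0 // => y.
by rewrite eq_sym => /negPf->.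
Qed.

Definition mffact a u : nat := (\prod_(i < n) (a i) ^_ (u i))%N.

Definition mnm_val a : 'I_n -> K := fun i => (a i)%:R.

Lemma ffpoly_val u a : (ffpoly K u).@[mnm_val a] = (mffact a u)%:R.
Proof.
rewrite /ffpoly /mffact rmorph_prod natr_prod; apply: eq_bigr => i _.
rewrite rmorph_prod; elim: (u i) => [|k ih]; first by rewrite big_ord0 ffactn0.
rewrite big_ord_recr /= ih ffactnSr natrM mevalB mevalXU mevalC.
have [ka|ak] := leqP k (a i); first by rewrite natrB.
by rewrite ffact_small // !mul0r.
Qed.

Lemma mffact_eq0 a u i : (a i < u i)%N -> mffact a u = 0%N.
Proof. by move=> h; rewrite /mffact (bigD1 i) //= ffact_small. Qed.

(** A pair (u, v) stands for a term x^v d^u. Since x^u d^u is a polynomial in the delta_i,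
    multiplying the term by x^mm leaves the power of x given by [shift], and the terms are grouped
    by it. *)
Let pairs P := [seq (u, v) | u <- msupp P, v <- msupp P@_u].
Let mm P : 'X_{1..n} := [multinom op_order P | i < n].
Let shift P (x : 'X_{1..n} * 'X_{1..n}) := (x.2 + (mm P - x.1))%MM.

Lemma ind_part_val P w a : (ind_part P w).@[mnm_val a] =
  \sum_(x <- pairs P | shift P x == w) (P@_x.1)@_x.2 * (mffact a x.1)%:R.
Proof.
rewrite big_mkcond big_allpairs_dep /ind_part rmorph_sum; apply: eq_bigr => u _.
rewrite rmorph_sum [LHS]big_mkcond; apply: eq_bigr => v _ /=.
by rewrite /shift /=; case: ifP => // _; rewrite mevalZ ffpoly_val.
Qed.

Lemma op_apply_pairs P f z : op_apply P f z =
  \sum_(x <- pairs P) if (x.2 <= z)%MM then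
     (P@_x.1)@_x.2 * ((mffact (z - x.2 + x.1)%MM x.1)%:R * f (z - x.2 + x.1)%MM) else 0.
Proof.
rewrite big_allpairs_dep; apply: eq_bigr => u _.
rewrite /fps_pmul [LHS]big_mkcond; apply: eq_bigr => v _ /=; case: ifP => // _.
rewrite /fps_der; congr (_ * (_%:R * _)); apply: eq_bigr => i _.
by rewrite mnmDE.
Qed.

Lemma mem_pairs_le P x : x \in pairs P -> forall i, (x.1 i <= mm P i)%N.
Proof.
case/allpairsPdep=> u [v [us _ ->]] i /=; rewrite mnmE.
apply: (@leq_trans (mdeg u)); first by rewrite mdegE (bigD1 i) //= leq_addr.
by rewrite /op_order (big_rem u us) /= leq_max leqnn.
Qed.

(** On x^a each x^u d^u acts as the scalar [mffact a u], so the terms of one shift [w] act together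
    by the value of [ind_part P w] at a. They reach x^z exactly from a = z + mm - w. *)
Lemma op_apply_fiber P f z w :
  \sum_(x <- pairs P | shift P x == w) (if (x.2 <= z)%MM then
     (P@_x.1)@_x.2 * ((mffact (z - x.2 + x.1)%MM x.1)%:R * f (z - x.2 + x.1)%MM) else 0) =
  if (w <= z + mm P)%MM then
    (ind_part P w).@[mnm_val (z + mm P - w)%MM] * f (z + mm P - w)%MM else 0.
Proof.
case: ifPn => [le|nle].
  rewrite ind_part_val mulr_suml big_seq_cond [RHS]big_seq_cond.
  apply: eq_bigr => -[u v] /andP[/mem_pairs_le /= hu /eqP wE].
  case: ifPn => [vz|nvz].
    have -> : (z - v + u = z + mm P - w)%MM.
      apply/mnmP => i; have := hu i; have := mnm_lepP vz i.
      by rewrite -wE /shift /= !(mnmBE, mnmDE); lia.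
    by rewrite mulrA.
  (* The left side omits this term. On the right its falling factorial vanishes, the i-th entry of
     the evaluation point being smaller than [u i]. *)
  have [i hi] : exists i, (z i < v i)%N.
    apply/existsP; apply: contraNT nvz => /existsPn h; apply/mnm_lepP => i.
    by rewrite leqNgt.
  rewrite (@mffact_eq0 _ u i) ?mulr0 ?mul0r //.
  by have := mnm_lepP le i; have := hu i; rewrite -wE /shift /= !(mnmBE, mnmDE); lia.
rewrite big_seq_cond big1 // => -[u v] /andP[/mem_pairs_le /= hu /eqP wE].
rewrite ifN //; apply: contraNN nle => vz; apply/mnm_lepP => i.
have := hu i; have := mnm_lepP vz i; rewrite -wE /shift /= !(mnmBE, mnmDE); lia.
Qed.

Lemma foldr_min (s : seq 'X_{1..n}) w0 :
  let t := foldr (fun a b => if lt a b then a else b) w0 s in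
  t \in w0 :: s /\ forall u, u \in w0 :: s -> lte t u.
Proof.
elim: s => [|a s [h1 h2]] /=.
  by rewrite inE eqxx; split=> // u; rewrite inE => /eqP->; apply: lte_refl.
set b := foldr _ _ s in h1 h2 *; case: ifPn => ab.
  split=> [|u]; first by rewrite !inE eqxx orbT.
  rewrite !inE => /or3P[/eqP->|/eqP->|us].
  - by apply/orP; right; apply: lt_lte_trans ab _ => //; apply: h2; rewrite mem_head.
  - exact: lte_refl.
  - by apply/orP; right; apply: lt_lte_trans ab _ => //; apply: h2; rewrite inE us orbT.
split=> [|u]; first by move: h1; rewrite !inE => /orP[->//|->]; rewrite !orbT.
have ba : lte b a by have /orP[//|h] := term_total hlt b a; rewrite h in ab.
rewrite !inE => /or3P[/eqP->|/eqP->//|us]; first by apply: h2; rewrite mem_head.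
by apply: h2; rewrite inE us orbT.
Qed.

(** The coefficient of x^(w0 + b) in x^mm P f is the value of ind(P) at b times [f b]: smaller
    shifts have zero indicial part, and larger ones would need an exponent of [f] below [b]. *)
Lemma ind_val_initial P f b : annihilator f P -> f b != 0 ->
  (forall w, f w != 0 -> lte b w) -> (ind lt P).@[mnm_val b] = 0.
Proof.
move=> hP fb hb; rewrite /ind.
have exps : ind_exps P = [seq w <- map (shift P) (pairs P) | ind_part P w != 0].
  by rewrite /ind_exps /pairs map_allpairs.
case E: (ind_exps P) => [|w1 ws]; first by rewrite meval0.
have := foldr_min ws w1; rewrite /= -E; move: (foldr _ _ _) => w0 [w0in w0min] {E}.
have low w : w \in map (shift P) (pairs P) -> lt w w0 -> ind_part P w = 0.
  move=> wP ww0; apply/eqP; apply: contraT => wnz.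
  have := w0min w; rewrite exps mem_filter wnz wP => /(_ isT) h.
  by have := lt_lte_trans hlt ww0 h; rewrite (lt_irr hlt).
(* Otherwise x^(w0 + b) is not a multiple of x^mm and no coefficient of P f corresponds to it; but
   then all falling factorials in the value at [b] are zero. *)
have [le|nle] := boolP (mm P <= w0 + b)%MM; last first.
  have [i hi] : exists i, ((w0 + b)%MM i < mm P i)%N.
    apply/existsP; apply: contraNT nle => /existsPn h; apply/mnm_lepP => i.
    by rewrite leqNgt.
  rewrite ind_part_val big_seq_cond big1 // => -[u v] /andP[/mem_pairs_le /= hu /eqP wE].
  rewrite (@mffact_eq0 _ u i) ?mulr0 //.
  by move: hi; have := hu i; rewrite -wE /shift /= !(mnmBE, mnmDE); lia.
pose z := (w0 + b - mm P)%MM.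
have zE : (z + mm P = w0 + b)%MM by rewrite /z submK.
have := hP z; rewrite op_apply_pairs (big_seq_fibers (shift P)).
under eq_bigr => w _ do rewrite op_apply_fiber zE.
rewrite (bigD1_seq w0) ?undup_uniq //=; last first.
  by rewrite mem_undup; move: w0in; rewrite exps mem_filter => /andP[].
rewrite lem_addr [(w0 + b)%MM]addmC addmK big_seq_cond big1.
  by rewrite addr0 => /eqP; rewrite mulf_eq0 (negPf fb) orbF => /eqP.
move=> w /andP[]; rewrite mem_undup => wP ww0; case: ifP => // le'.
have /orP[/orP[/eqP e|h]|h] := term_total hlt w w0.
- by rewrite e eqxx in ww0.
- by rewrite low // meval0 mul0r.
have [->|fa] := eqVneq (f (b + w0 - w)%MM) 0; first by rewrite mulr0.
have e : (w0 + b = w + (b + w0 - w))%MM by rewrite [RHS]addmC submK // addmC.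
have w0w : lte w0 w by apply/orP; right.
by have e' := lte_add_eq hlt e w0w (hb _ fa); rewrite e' eqxx in ww0.
Qed.

Lemma initial_in_cand G (S : seq 'X_{1..n}) f b : is_cand_set lt G S -> is_fps_sol G f ->
  f b != 0 -> (forall w, f w != 0 -> lte b w) -> b \in S.
Proof.
move=> [_ [fs [h1 _ h2]]] hf fb hb; rewrite h2; apply/allP => p pfs.
have [|P [PG <-]] := h1 p.
  have pi : (index p fs < size fs)%N by rewrite index_mem.
  exists (mkseq (fun k => (k == index p fs)%:R) (size fs)); split; first by rewrite size_mkseq.
  rewrite (bigD1 (Ordinal pi)) //= nth_mkseq // eqxx mul1r nth_index // big1 ?addr0 // => k.
  by rewrite -val_eqE /= => /negPf kg; rewrite nth_mkseq // kg mul0r.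
by apply/eqP; apply: (ind_val_initial (sol_in_rlideal hlt hf PG) fb hb).
Qed.
End Indicial.

(** * Wronskians of solutions with prescribed initial exponents *)

Lemma seq_choice (I : eqType) (T : Type) (t0 : T) (s : seq I) (Q : I -> T -> Prop) :
  (forall x, x \in s -> exists t, Q x t) -> exists F : I -> T, forall x, x \in s -> Q x (F x).
Proof.
elim: s => [|x s ih] h; first by exists (fun=> t0).
have [|F hF] := ih; first by move=> y ys; apply: h; rewrite inE ys orbT.
have [t ht] := h x (mem_head _ _); exists (fun y => if y == x then t else F y) => y.
by rewrite inE; case: eqP => [->|_ /hF].
Qed.

Lemma seq_filter_prop (I : eqType) (s : seq I) (Q : I -> Prop) : uniq s ->
  exists t, uniq t /\ forall x, x \in t <-> x \in s /\ Q x.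
Proof.
elim: s => [|x s ih] /=; first by exists [::]; split=> // x; rewrite in_nil; split=> [|[]].
case/andP=> xs /ih[t [ut ht]].
have [Qx|nQx] := Classical_Prop.classic (Q x).
  exists (x :: t); split=> [/=|y].
    by rewrite ut andbT; apply: contraNN xs => /ht[].
  rewrite !inE; split=> [/orP[/eqP->|/ht[-> ?]]|[/orP[->//|ys] Qy]].
  - by rewrite eqxx.
  - by rewrite orbT.
  - by apply/orP; right; apply/ht.
exists t; split=> // y; rewrite inE; split=> [/ht[ys Qy]|[/orP[/eqP->//|ys] Qy]].
  by rewrite ys orbT.
exact/ht.
Qed.

Section Solutions.
Variables (K : fieldType) (n : nat) (lt : rel 'X_{1..n}).
Hypothesis charK : [pchar K] =i pred0.
Hypothesis hlt : graded_term_order lt.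
Implicit Types (c : {mpoly K[n]}) (P : {mpoly {mpoly K[n]}[n]}) (f g : fps K n)
  (u v w : 'X_{1..n}).
Local Notation lte := (lte lt).

Definition initial f b := f b != 0 /\ forall w, f w != 0 -> lte b w.

Definition fps_comb d (fs : 'I_d -> fps K n) (c : 'I_d -> K) : fps K n :=
  fun w => \sum_i c i * fs i w.

Lemma op_apply_comb d (fs : 'I_d -> fps K n) (c : 'I_d -> K) P w :
  op_apply P (fps_comb fs c) w = \sum_i c i * op_apply P (fs i) w.
Proof.
under [RHS]eq_bigr => i _ do rewrite mulr_sumr.
rewrite [RHS]exchange_big; apply: eq_bigr => u _ /=.
under [RHS]eq_bigr => i _ do rewrite mulr_sumr.
rewrite [RHS]exchange_big; apply: eq_bigr => v _ /=.
rewrite /fps_der /fps_comb !mulr_sumr; apply: eq_bigr => i _; ring.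
Qed.

(** If the span had fewer than d initial exponents, some nontrivial combination would have zero
    coefficients at all of them, and its own initial exponent would be a further one. *)
Lemma initial_exponents d (fs : 'I_d -> fps K n) (S : seq 'X_{1..n}) : uniq S ->
  fps_lin_indep fs -> (forall x b, initial (fps_comb fs x) b -> b \in S) ->
  exists B, [/\ uniq B, {subset B <= S}, size B = d &
    forall b, b \in B -> exists x, initial (fps_comb fs x) b].
Proof.
move=> uS ind inS.
have [E [uE hE]] := seq_filter_prop (fun b => exists x, initial (fps_comb fs x) b) uS.
suff dE : (d <= size E)%N.
  exists (take d E); split.
  - exact: take_uniq.
  - by move=> b /mem_take /hE[].
  - exact: size_takel.
  - by move=> b /mem_take /hE[].
rewrite leqNgt; apply/negP => Ed.
have [x x0 xA] := left_kernel_wide (\matrix_(i < d, j < size E) fs i (nth 0%MM E j)) Ed.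
pose f := fps_comb fs (fun i => x 0 i).
have [w fw] : exists w, f w != 0.
  have [//|none] := Classical_Prop.classic (exists w, f w != 0).
  case/eqP: x0; apply/rowP => i; rewrite mxE; apply: (ind (fun i => x 0 i)) => w.
  by apply/eqP; apply: contraT => fw; case: none; exists w.
have [b fb hb] := lt_min_exists hlt (ex_intro (fun w => f w != 0) w fw).
have bE : b \in E.
  by apply/hE; split; [apply: (inS (fun i => x 0 i))|exists (fun i => x 0 i)].
have bi : (index b E < size E)%N by rewrite index_mem.
have := congr1 (fun M : 'rV_(size E) => M 0 (Ordinal bi)) xA; rewrite !mxE => e.
case/eqP: fb; rewrite -[RHS]e; apply: eq_bigr => i _; by rewrite mxE nth_index.
Qed.

Lemma mfact_neq0 u : (mfact u)%:R != 0 :> K.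
Proof.
rewrite (pcharf0P K).1 // /mfact -lt0n prodn_gt0 // => i; exact: fact_gt0.
Qed.

Section Family.
Variables (U : seq 'X_{1..n}) (F : 'X_{1..n} -> fps K n).
Hypothesis uU : uniq U.
Hypothesis hF : forall u, u \in U -> initial (F u) u.

(** The matrix entries are the values of d^w F_u at the origin, which vanish for w below u. In the
    row of the largest exponent of [y] only the diagonal term survives. *)
Lemma wronskian0_inj (y : 'X_{1..n} -> K) :
  (forall u, u \in U -> \sum_(w <- U) y w * ((mfact w)%:R * F u w) = 0) ->
  forall w, w \in U -> y w = 0.
Proof.
move=> hy w wU; apply/eqP; apply: contraT => yw.
pose s := [seq w <- U | y w != 0].
have ws : w \in s by rewrite mem_filter yw.
have [|t] := lt_max_seq hlt (s := s); first by apply: contraTneq ws => ->.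
rewrite mem_filter => /andP[yt tU] ht; have [Ft ht'] := hF tU.
have := hy t tU; rewrite (bigD1_seq t) //= big_seq_cond big1 ?addr0.
  by move/eqP; rewrite !mulf_eq0 (negPf yt) (negPf Ft) (negPf (mfact_neq0 t)).
move=> z /andP[zU zt]; have [->|yz] := eqVneq (y z) 0; first by rewrite mul0r.
have [->|Fz] := eqVneq (F t z) 0; first by rewrite !mulr0.
have /orP[/eqP e|zlt] : lte z t by apply: ht; rewrite mem_filter yz.
  by rewrite e eqxx in zt.
by have := lt_lte_trans hlt zlt (ht' z Fz); rewrite (lt_irr hlt).
Qed.

(** Let [a] be the lowest exponent of x in any coefficient of [P]. The coefficient of x^a in P F_u
    involves only the values of the d^w F_u at the origin, so the Wronskian at 0 forces all
    coefficients at [a] to be zero. *)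
Lemma low_annihilator_eq0 P : (forall u, P@_u != 0 -> u \in U) ->
  (forall u, u \in U -> annihilator (F u) P) -> P = 0.
Proof.
move=> hP hann; apply/eqP; apply: contraT => P0.
have [w0 w0P] : exists w, P@_w != 0 by exists (hterm lt P); case: (hterm_spec hlt P0).
have [a0 ha0] : exists a, (P@_w0)@_a != 0.
  by have [a ? _] := mpoly_lowest hlt w0P; exists a.
have [a [w wa] ha] := lt_min_exists hlt
  (ex_intro (fun a => exists w, (P@_w)@_a != 0) a0 (ex_intro _ w0 ha0)).
have wU : w \in U by apply: hP; apply: contra_neq wa => ->; rewrite mcoeff0.
have := @wronskian0_inj (fun w => (P@_w)@_a) _ w wU; move/eqP: wa => wa h; case: wa; apply: h.
move=> u uUu; have := hann u uUu a; rewrite /op_apply.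
rewrite (@big_msupp_sub _ _ _ (fun w c => fps_pmul c (fps_der w (F u)) a) _ P U) //; last first.
- by move=> z; rewrite mcoeff_msupp; apply: hP.
- by move=> z; apply: fps_pmulDl.
move=> e; rewrite -[RHS]e; apply: eq_bigr => z _.
rewrite -fps_der_at0 -[X in fps_pmul _ _ X]addm0 (fps_pmul_lowest hlt) // => z' hz'.
  by apply: ha; exists z.
by apply: lem_lte => //; apply/mnm_lepP => i; rewrite mnm0E.
Qed.
End Family.
End Solutions.

(** * Nonvanishing of head coefficients at the origin *)

Section Ordinary.
Variables (K : fieldType) (n : nat) (lt : rel 'X_{1..n}).
Hypothesis charK : [pchar K] =i pred0.
Hypothesis hlt : graded_term_order lt.
Implicit Types (a b c : {mpoly K[n]}) (P : {mpoly {mpoly K[n]}[n]}) (f g : fps K n)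
  (u v w : 'X_{1..n}).
Local Notation lte := (lte lt).

Lemma lte0m u : lte 0%MM u.
Proof. by apply: lem_lte => //; apply/mnm_lepP => i; rewrite mnm0E. Qed.

Lemma mcoeffM_lowest a b u v : (forall w, a@_w != 0 -> lte u w) ->
  (forall w, b@_w != 0 -> lte v w) -> (a * b)@_(u + v)%MM = a@_u * b@_v.
Proof. by move=> ha hb; rewrite mcoeffM_pmul (fps_pmul_lowest hlt ha hb). Qed.

Lemma mcoeffM_low a b u v z : (forall w, a@_w != 0 -> lte u w) ->
  (forall w, b@_w != 0 -> lte v w) -> lt z (u + v)%MM -> (a * b)@_z = 0.
Proof.
move=> ha hb hz; rewrite mcoeffM_pmul /fps_pmul big1 // => w wz.
have [->|aw] := eqVneq a@_w 0; first by rewrite mul0r.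
have [->|bw] := eqVneq b@_(z - w) 0; first by rewrite mulr0.
have h1 := lte_add2r hlt v (ha _ aw); have h2 := lte_add2r hlt w (hb _ bw).
rewrite submK // addmC in h2; rewrite addmC [(w + v)%MM]addmC in h1.
rewrite addmC in hz.
have := lt_lte_trans hlt hz (lte_trans hlt h1 _); move/(_ z).
by rewrite [(v + w)%MM]addmC h2 (lt_irr hlt) => /(_ isT).
Qed.

(* [flat N] is the N+1-st power of the maximal ideal of K[x] at the origin *)
Definition flat N a := forall w, (mdeg w <= N)%N -> a@_w = 0.

Lemma flatD N a b : flat N a -> flat N b -> flat N (a + b).
Proof. by move=> ha hb w hw; rewrite mcoeffD ha // hb // addr0. Qed.

Lemma flat0 N : flat N 0.
Proof. by move=> w _; rewrite mcoeff0. Qed.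

Lemma flatMl N a b : flat N b -> flat N (a * b).
Proof.
move=> hb w hw; rewrite mcoeffM_pmul /fps_pmul big1 // => v vw.
rewrite hb ?mulr0 //; exact: leq_trans (mdegB _ _) hw.
Qed.

Lemma flatMr N a b : flat N b -> flat N (b * a).
Proof. by rewrite mulrC; apply: flatMl. Qed.

Lemma flat_sum N (I : Type) (s : seq I) (p : pred I) (G : I -> {mpoly K[n]}) :
  (forall i, p i -> flat N (G i)) -> flat N (\sum_(i <- s | p i) G i).
Proof.
move=> h; elim/big_rec: _ => [|i x pi hx]; [exact: flat0|exact: flatD (h i pi) hx].
Qed.

(** Truncation keeps the Wronskian matrix and its adjugate over K[x], at the price of congruences
    modulo [flat N]. *)
Definition truncate N f : {mpoly K[n]} := \sum_(w : 'X_{1..n < N.+1}) f w *: 'X_[w].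

Lemma mcoeff_truncate N f w : (mdeg w <= N)%N -> (truncate N f)@_w = f w.
Proof. by move=> hw; rewrite /truncate mcoeff_mpoly. Qed.

Lemma mcoeffM_truncate N a f w : (mdeg w <= N)%N ->
  (a * truncate N f)@_w = fps_pmul a f w.
Proof.
move=> hw; rewrite mcoeffM_pmul; apply: eq_bigr => v _.
by rewrite mcoeff_truncate //; apply: leq_trans (mdegB _ _) hw.
Qed.

Lemma const_unit (dv : {mpoly K[n]}) : divides dv 1 -> exists k : K, k != 0 /\ dv = k%:MP.
Proof.
case=> q /esym /mpoly_intro_unit /andP[/eqP h]; rewrite unitfE => k0.
by exists dv@_0; split.
Qed.

(* A coefficient c with c(0) = 0 that divides all coefficients of P up to the unit D of K[[x]]
   would contradict primitivity: eliminating a variable x_i that occurs in the lowest term of c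
   gives r free of x_i, while the lowest term of D r is a multiple of that of c. *)
Lemma primitive_coeff_neq0 P c : primitive_op P -> c \in [seq P@_u | u <- msupp P] ->
  (forall N, exists D, D@_0 != 0 /\ forall u, exists t, flat N (D * P@_u - c * t)) ->
  c@_0 != 0.
Proof.
move=> pP cP hD; apply/negP => /eqP c00.
have c0 : c != 0 by case/mapP: cP => u; rewrite mcoeff_msupp => h ->.
have [b cb hb] := mpoly_lowest hlt c0.
have [i bi] : exists i, b i != 0%N.
  apply/existsP; apply: contra_neqT cb => /existsPn h.
  suff -> : b = 0%MM by [].
  by apply/mnmP => i; rewrite mnm0E; apply/eqP; have := h i; rewrite negbK.
pose s := undup [seq P@_u | u <- msupp P].
have [|||a [r [r0 ri rE]]] := @mpoly_elimination K n i s.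
- exact: undup_uniq.
- move=> e he; have [|k [k0 ->]] := pP e.
    move=> u; have [hu|/memN_msupp_eq0->] := boolP (u \in msupp P); last exact: divides0.
    by apply: he; rewrite mem_undup; apply: (map_f (fun u => P@_u)).
  by exists (k^-1)%:MP; rewrite -mpolyCM mulVf.
- by exists c; rewrite ?mem_undup.
have [p rp hp] := mpoly_lowest hlt r0.
(* This precision is enough: coefficients are compared only at [p] and below it, in degrees at most
   [mdeg p] since the order is graded. *)
have [D [D0 hDu]] := hD (mdeg p).
have [T hT] : exists T, flat (mdeg p) (D * r - c * T).
  rewrite -rE; have : {subset s <= [seq P@_u | u <- msupp P]} by move=> x; rewrite mem_undup.
  elim: (s) => [|f s' ih] sub.
    by exists 0; rewrite big_nil !mulr0 subr0; apply: flat0.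
  have [|T hT] := ih; first by move=> x xs; apply: sub; rewrite inE xs orbT.
  have /mapP[u _ fE] := sub f (mem_head _ _); have [t ht] := hDu u.
  exists (a f * t + T); rewrite big_cons.
  have -> : D * (a f * f + \sum_(j <- s') a j * j) - c * (a f * t + T) =
      a f * (D * P@_u - c * t) + (D * (\sum_(j <- s') a j * j) - c * T).
    by rewrite fE; ring.
  by apply: flatD => //; apply: flatMl.
have cTE z : (mdeg z <= mdeg p)%N -> (c * T)@_z = (D * r)@_z.
  by move=> hz; have := hT z hz; rewrite mcoeffB => /eqP; rewrite subr_eq0 => /eqP->.
have cTp : (c * T)@_p != 0.
  rewrite cTE // -[p]add0m (mcoeffM_lowest (fun w _ => lte0m w) hp).
  by rewrite mulf_neq0.
have cTlow z : lt z p -> (c * T)@_z = 0.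
  move=> zp; rewrite cTE ?(lt_mdeg hlt) //; apply: (mcoeffM_low (fun w _ => lte0m w) hp).
  by rewrite add0m.
have T0 : T != 0 by apply: contra_neq cTp => ->; rewrite mulr0 mcoeff0.
have [q Tq hq] := mpoly_lowest hlt T0.
have E : p = (b + q)%MM.
  have /orP[/orP[/eqP//|h]|h] := term_total hlt p (b + q)%MM.
    by case/eqP: cTp; apply: (mcoeffM_low hb hq).
  have := cTlow _ h; rewrite (mcoeffM_lowest hb hq) => /eqP.
  by rewrite mulf_eq0 (negPf cb) (negPf Tq).
by have := ri p rp; rewrite E mnmDE => /eqP; rewrite addn_eq0 (negPf bi).
Qed.

Section Family.
Variables (U : seq 'X_{1..n}) (F : 'X_{1..n} -> fps K n).
Hypothesis uU : uniq U.
Hypothesis hF : forall u, u \in U -> initial lt (F u) u.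

(** The equations P F_u = 0 form a square linear system for the coefficients of [P] at [U], with
    right side a multiple of [P@_v]. The unit D is the determinant of [W], and Cramer's rule is
    multiplication by the adjugate. *)
Lemma hcoeff_ordinary P v : v \notin U -> P@_v != 0 ->
  (forall u, P@_u != 0 -> u \in v :: U) -> primitive_op P ->
  (forall u, u \in U -> annihilator (F u) P) -> (P@_v)@_0 != 0.
Proof.
move=> vU Pv hP pP hann; apply: (primitive_coeff_neq0 pP).
  by apply: map_f; rewrite mcoeff_msupp.
move=> N; pose e i := nth 0%MM U i.
pose W : 'M[{mpoly K[n]}]_(size U) := \matrix_(i, j) truncate N (fps_der (e i) (F (e j))).
pose t : 'rV[{mpoly K[n]}]_(size U) := \row_j truncate N (fps_der v (F (e j))).
pose p : 'rV[{mpoly K[n]}]_(size U) := \row_i P@_(e i).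
have eU (i : 'I_(size U)) : e i \in U by apply: mem_nth.
have rel j : flat N ((p *m W) 0 j + P@_v * t 0 j).
  move=> w hw; have := hann _ (eU j) w; rewrite /op_apply.
  rewrite (@big_msupp_sub _ _ _ (fun z c => fps_pmul c (fps_der z (F (e j))) w) _ P (v :: U)).
  - rewrite big_cons addrC (big_nth 0%MM) big_mkord => E; rewrite -[RHS]E.
    rewrite mcoeffD !mxE mcoeffM_truncate //; congr (_ + _).
    rewrite raddf_sum /=; apply: eq_bigr => i _.
    by rewrite !mxE mcoeffM_truncate.
  - by move=> z; apply: fps_pmulDl.
  - by rewrite /= vU.
  - by move=> z; rewrite mcoeff_msupp; apply: hP.
exists (\det W); split.
  (* At the origin [W] becomes the triangular matrix of [wronskian0_inj]. *)
  have -> : (\det W)@_0 = \det (map_mx (mcoeff 0%MM) W) by rewrite det_map_mx.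
  apply/det0P => -[y y0 yW]; case/eqP: y0; apply/rowP => i; rewrite mxE.
  pose y' w := \sum_(k < size U | e k == w) y 0 k.
  have y'E (k : 'I_(size U)) : y' (e k) = y 0 k.
    by rewrite /y' (big_pred1 k) // => l; rewrite /= /e nth_uniq.
  rewrite -y'E; apply: (wronskian0_inj charK hlt uU hF) => // u uUu.
  have iu : (index u U < size U)%N by rewrite index_mem.
  have := congr1 (fun M : 'rV_(size U) => M 0 (Ordinal iu)) yW; rewrite !mxE => E.
  rewrite -[RHS]E (big_nth 0%MM) big_mkord; apply: eq_bigr => k _.
  rewrite -/(e k) y'E.
  by rewrite !mxE mcoeff_truncate ?mdeg0 // fps_der_at0 /e /= nth_index.
move=> u; have [Pu|/hP] := eqVneq P@_u 0.
  by exists 0; rewrite Pu !mulr0 subr0; apply: flat0.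
rewrite inE => /orP[/eqP->|uUu].
  by exists (\det W); rewrite mulrC subrr; apply: flat0.
have iu : (index u U < size U)%N by rewrite index_mem.
exists (- (t *m \adj W) 0 (Ordinal iu)).
have -> : \det W * P@_u - P@_v * - (t *m \adj W) 0 (Ordinal iu) =
    \sum_j ((p *m W) 0 j + P@_v * t 0 j) * (\adj W) j (Ordinal iu).
  under [RHS]eq_bigr => j _ do rewrite mulrDl -mulrA.
  rewrite big_split -mulr_sumr mulrN opprK /=.
  congr (_ + _ * _); last by rewrite mxE.
  transitivity ((p *m W *m \adj W) 0 (Ordinal iu)); last by rewrite mxE.
  by rewrite -mulmxA mul_mx_adj mul_mx_scalar !mxE /e /= nth_index.
by apply: flat_sum => j _; apply: flatMr.
Qed.
End Family.
End Ordinary.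

(** * The reduced Groebner basis of the intersection ideal *)

Section ReducedBasis.
Variables (K : fieldType) (n : nat) (lt : rel 'X_{1..n}).
Hypothesis charK : [pchar K] =i pred0.
Hypothesis hlt : graded_term_order lt.
Implicit Types (a b c : {mpoly K[n]}) (P Q : {mpoly {mpoly K[n]}[n]}) (f : fps K n)
  (u v w : 'X_{1..n}).
Local Notation lte := (lte lt).

Lemma primitive_part P : P != 0 -> exists c Q, [/\ c != 0, P = c *: Q & primitive_op Q].
Proof.
move=> P0; have [g [h1 h2]] := gcd_exists (@gcd_domain_mpoly K n) [seq P@_u | u <- msupp P].
have [|q hq] := @seq_choice _ _ (0 : {mpoly K[n]}) (msupp P) (fun u x => P@_u = x * g).
  by move=> u us; apply: h1; apply: (map_f (fun u => P@_u)).
pose Q : {mpoly {mpoly K[n]}[n]} := \sum_(u <- msupp P) q u *: 'X_[u].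
have PE : P = g *: Q.
  rewrite [LHS]mpolyE /Q scaler_sumr big_seq [RHS]big_seq; apply: eq_bigr => u us.
  by rewrite scalerA mulrC -hq.
have g0 : g != 0 by apply: contra_neq P0 => g0; rewrite PE g0 scale0r.
exists g, Q; split=> // dv hdv; apply: const_unit.
apply/(divides_mul2l _ _ g0); rewrite mulr1; apply: h2 => _ /mapP[u _ ->].
rewrite [X in X@_u]PE mcoeffZ; apply: divides_mul_mono; first exact: divides_refl.
exact: hdv.
Qed.

Lemma exists_lem_mdeg (t : 'X_{1..n}) k : (k <= mdeg t)%N -> exists2 v, (v <= t)%MM & mdeg v = k.
Proof.
elim/mnm_ind: t => [|t i ih].
  by rewrite mdeg0 leqn0 => /eqP->; exists 0%MM; rewrite ?lepm_refl ?mdeg0.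
rewrite mdegD mdeg1 addn1 leq_eqVlt => /orP[/eqP->|].
  by exists (t + U_(i))%MM; rewrite ?lepm_refl // mdegD mdeg1 addn1.
rewrite ltnS => /ih[v vt vk]; exists v => //; apply: lepm_trans vt _; exact: lem_addr.
Qed.

Section Family.
Variables (m : nat) (F : 'X_{1..n} -> fps K n) (L : {mpoly {mpoly K[n]}[n]} -> Prop).
Let U : seq 'X_{1..n} := exps_upto n m.
Hypothesis hF : forall u, (mdeg u <= m)%N -> initial lt (F u) u.
Hypothesis sL : saturated L.
Hypothesis rankL : rank_le L (size U).
Hypothesis annL : forall P u, L P -> (mdeg u <= m)%N -> annihilator (F u) P.

Let uU : uniq U. Proof. exact: uniq_exps_upto. Qed.
Let memU u : (u \in U) = (mdeg u <= m)%N. Proof. exact: mem_exps_upto. Qed.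

Lemma low_eq0 P : L P -> (forall u, P@_u != 0 -> (mdeg u <= m)%N) -> P = 0.
Proof.
move=> LP hP; apply: (low_annihilator_eq0 charK hlt uU (F := F)).
- by move=> u; rewrite memU; apply: hF.
- by move=> u /hP; rewrite memU.
- by move=> u; rewrite memU; apply: annL.
Qed.

Lemma exists_basis_element v : mdeg v = m.+1 -> exists P, [/\ L P, P@_v != 0,
  (forall u, P@_u != 0 -> u = v \/ (mdeg u <= m)%N) & primitive_op P].
Proof.
move=> vm; have vU : v \notin U by rewrite memU vm ltnn.
pose e i := nth 0%MM (v :: U) i.
have [x [[j xj] LP]] := rank_le_dependent
  (fun j : 'I_(size U).+1 => 'X_[e j] : {mpoly {mpoly K[n]}[n]}) rankL (ltnSn _).
set P := \sum_j _ in LP.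
have ue : uniq (v :: U) by rewrite /= vU.
have PE (k : 'I_(size U).+1) : P@_(e k) = x k.
  rewrite /P raddf_sum (bigD1 k) //= mcoeffZ mcoeffX eqxx mulr1 big1 ?addr0 // => l lk.
  by rewrite mcoeffZ mcoeffX /e nth_uniq // val_eqE (negPf lk) mulr0.
have hP u : P@_u != 0 -> u = v \/ (mdeg u <= m)%N.
  rewrite /P raddf_sum => h; have : u \in v :: U.
    apply: contraNT h => uU'; rewrite big1 // => k _ /=.
    rewrite mcoeffZ mcoeffX; case: eqP => [E|]; last by rewrite mulr0.
    by rewrite -E mem_nth in uU'.
  by rewrite inE memU => /orP[/eqP->|]; [left|right].
have P0 : P != 0.
  by apply: contra_neq xj => P0; rewrite -PE P0 mcoeff0.
(* Without [v] the relation would be supported in U and hence be zero. *)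
have Pv : P@_v != 0.
  apply: contra_neq P0 => Pv; apply: low_eq0 => // u Pu.
  by case: (hP u Pu) => // E; rewrite E Pv eqxx in Pu.
have [c [Q [c0 QE pQ]]] := primitive_part P0; exists Q; split=> //.
- by apply: (sL c0); rewrite -QE.
- by apply: contra_neq Pv; rewrite QE mcoeffZ => ->; rewrite mulr0.
- by move=> u Qu; apply: hP; rewrite QE mcoeffZ mulf_neq0.
Qed.

Lemma mevals0 a : a.@[fun=> 0] = a@_0.
Proof.
elim/mpoly_term_ind: a => [|a b ha hb|k u]; first by rewrite meval0 mcoeff0.
  by rewrite mevalD mcoeffD ha hb.
rewrite mevalZ mevalX mcoeffZ mcoeffX; congr (_ * _).
have [->|u0] := eqVneq u 0%MM; first by rewrite big1 // => i _; rewrite mnm0E.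
have [i ui] : exists i, u i != 0%N.
  apply/existsP; apply: contra_neqT u0 => /existsPn h.
  by apply/mnmP => i; rewrite mnm0E; apply/eqP; have := h i; rewrite negbK.
by rewrite (bigD1 i) //= expr0n (negPf ui) mul0r.
Qed.

Lemma ordinary0_of_hcoeff (M : seq {mpoly {mpoly K[n]}[n]}) :
  (forall g, g \in M -> (hcoeff lt g)@_0 != 0) -> ordinary0 lt M.
Proof.
move=> hM [l [[_ lmin] l0]]; pose q := \prod_(p <- [seq hcoeff lt g | g <- M]) p.
have [|r qE] := lmin q.
  move=> p pM; rewrite /q (big_rem p) //=.
  by exists (\prod_(y <- rem p [seq hcoeff lt g | g <- M]) y); rewrite mulrC.
have : q.@[fun=> 0] != 0.
  rewrite /q rmorph_prod big_map prodf_seq_neq0; apply/allP => g /hM.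
  by rewrite /= mevals0.
by rewrite qE mevalM l0 mulr0 eqxx.
Qed.

(** One element is taken for each exponent of degree m + 1. Nonzero elements of [L] have head terms
    of degree above m, so these heads divide them all; the tails have degree at most m, so none of
    their terms is divisible by a head. *)
Lemma reduced_basis_ordinary : exists M, is_reduced_GB lt L M /\ ordinary0 lt M.
Proof.
pose V := [seq v <- exps_upto n m.+1 | mdeg v == m.+1].
have memV v : (v \in V) = (mdeg v == m.+1).
  by rewrite mem_filter mem_exps_upto; case: eqP => // ->; rewrite leqnn.
have [|g hg] := @seq_choice _ _ (0 : {mpoly {mpoly K[n]}[n]}) V
  (fun v P => [/\ L P, P@_v != 0, (forall u, P@_u != 0 -> u = v \/ (mdeg u <= m)%N) &
    primitive_op P]).
  by move=> v; rewrite memV => /eqP; apply: exists_basis_element.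
have gt v : v \in V -> hterm lt (g v) = v.
  move=> vV; have [_ h1 h2 _] := hg v vV; move: vV; rewrite memV => /eqP vm.
  apply: (hterm_eq hlt) => // u /h2[->|um]; first exact: lte_refl.
  by apply/orP; right; apply: mdeg_lt => //; rewrite vm ltnS.
have g0 v : v \in V -> g v != 0.
  by move=> vV; have [_ h1 _ _] := hg v vV; apply: contra_neq h1 => ->; rewrite mcoeff0.
exists (map g V); split; last first.
  apply: ordinary0_of_hcoeff => _ /mapP[v vV ->]; rewrite /hcoeff gt //.
  have [Lg h1 h2 pg] := hg v vV; have vm : mdeg v = m.+1 by apply/eqP; rewrite -memV.
  apply: (hcoeff_ordinary charK hlt uU (F := F)) => //.
  - by move=> u; rewrite memU; apply: hF.
  - by rewrite memU vm ltnn.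
  - by move=> u /h2[->|h]; rewrite inE ?eqxx // memU h orbT.
  - by move=> u; rewrite memU; apply: annL.
split.
- split=> [_ /mapP[v vV ->]|P P0 LP].
    by split; [apply: g0|case: (hg v vV)].
  have [h1 h2] := hterm_spec hlt P0.
  have [|v vt vm] := @exists_lem_mdeg (hterm lt P) m.+1.
    rewrite ltnNge; apply: contra_neqN P0 => tm; apply: low_eq0 => // u /h2 ut.
    exact: leq_trans (lte_mdeg hlt ut) tm.
  have vV : v \in V by rewrite memV vm.
  by exists (g v); [apply: map_f|rewrite gt].
- rewrite map_inj_in_uniq ?filter_uniq ?uniq_exps_upto // => v w vV wV e.
  by rewrite -(gt v vV) e gt.
- by move=> _ /mapP[v vV ->]; case: (hg v vV).
- move=> _ _ u /mapP[v vV ->] /mapP[w wV ->]; rewrite mcoeff_msupp gt // => hu wu.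
  have [_ _ h2 _] := hg v vV; move: vV wV (vV); rewrite !memV => /eqP vm /eqP wm vV.
  have wu' : (mdeg w <= mdeg u)%N by apply: (lte_mdeg hlt); apply: (lem_lte hlt).
  case: (h2 u hu) => [uv|um]; last by have := leq_trans wu' um; rewrite wm ltnn.
  have wv : w = v.
    rewrite uv in wu; have := submK wu => E.
    have : mdeg (v - w)%MM = 0%N.
      by move: (congr1 (@mdeg n) E); rewrite mdegD wm vm; lia.
    by move/eqP; rewrite mdeg_eq0 => /eqP z; rewrite -E z add0m.
  by rewrite wv uv gt // memV vm.
Qed.
End Family.

Lemma inter_ideal_left_ideal G m B : left_ideal (@inter_ideal K n G m B).
Proof.
have [g0 gD gZ gd] := in_rlideal_left_ideal G.
have E u : left_ideal (in_rlideal (euler_ops K u)) := in_rlideal_left_ideal _.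
split.
- by split=> // u _ _; case: (E u).
- move=> P Q [h1 h2] [h3 h4]; split; first exact: gD.
  by move=> u um uB; case: (E u) => _ D _ _; apply: D; [apply: h2|apply: h4].
- move=> c P [h1 h2]; split; first exact: gZ.
  by move=> u um uB; case: (E u) => _ _ Z _; apply: Z; apply: h2.
- move=> i P [h1 h2]; split; first exact: gd.
  by move=> u um uB; case: (E u) => _ _ _ d; apply: d; apply: h2.
Qed.

Lemma inter_ideal_saturated G m B : saturated (@inter_ideal K n G m B).
Proof.
move=> c P c0 [h1 h2]; split; first exact: in_rlideal_saturated h1.
by move=> u um uB; apply: in_rlideal_saturated c0 _; apply: h2.
Qed.

Lemma rank_inter_ideal G m B d : is_GB lt (in_rlideal G) G -> is_rank lt G d ->
  rank_le (@inter_ideal K n G m B) (d + size [seq u <- exps_upto n m | u \notin B]).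
Proof.
move=> hG hd; set T := filter _ _.
have := rank_le_inter_seq T (rank_le_GB hlt (in_rlideal_left_ideal G) hG hd).
apply: rank_le_ext => P; split=> -[h1 h2]; split=> // u.
  by move=> um uB; apply: h2; rewrite mem_filter uB mem_exps_upto.
by rewrite mem_filter mem_exps_upto => /andP[uB um]; apply: h2.
Qed.

Lemma apparent_ordinary G d S (m := (\max_(u <- S) mdeg u)%N) :
  is_GB lt (in_rlideal G) G -> is_rank lt G d -> @is_cand_set K n lt G S ->
  (exists fs : 'I_d -> fps K n, (forall i, is_fps_sol G (fs i)) /\ fps_lin_indep fs) ->
  exists B : seq 'X_{1..n}, [/\ uniq B, {subset B <= S}, size B = d &
    exists M, is_reduced_GB lt (@inter_ideal K n G m B) M /\ ordinary0 lt M].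
Proof.
move=> hG hd hS [fs [hfs ifs]].
have sol_comb x : is_fps_sol G (fps_comb fs x).
  move=> g gG w; rewrite op_apply_comb big1 // => i _.
  by rewrite (hfs i g gG w) mulr0.
have [|B [uB BS sB hB]] := initial_exponents hlt (S := S) (proj1 hS) ifs.
  by move=> x b [fb hb]; apply: (initial_in_cand hlt hS (sol_comb x) fb hb).
exists B; split=> //.
have Bm u : u \in B -> (mdeg u <= m)%N.
  by move=> /BS uS; rewrite /m (big_rem u) //= leq_maxl.
have [f hf] := seq_choice (fps_comb fs (fun=> 0)) (s := B)
  (Q := fun u f => is_fps_sol G f /\ initial lt f u)
  (fun u uB => let: ex_intro x h := hB u uB in
     ex_intro _ (fps_comb fs x) (conj (sol_comb x) h)).
pose F u := if u \in B then f u else monomial_fps K u.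
apply: (@reduced_basis_ordinary m F).
- move=> u um; rewrite /F; case: ifP => [/hf[]//|_].
  rewrite /initial /monomial_fps eqxx oner_neq0; split=> // w.
  by case: (w =P u) => [->|_]; [rewrite lte_refl|rewrite eqxx].
- exact: inter_ideal_saturated.
- have := rank_inter_ideal m B hG hd; congr rank_le.
  (* Here [size B = d] and the inclusion of B in U_m turn d + |U_m - B| into |U_m|. *)
  rewrite -sB -[RHS](count_predC (mem B)) !size_filter; congr (_ + _)%N.
  rewrite -size_filter; apply/perm_size/uniq_perm => //.
    by rewrite filter_uniq // uniq_exps_upto.
  move=> b; rewrite mem_filter mem_exps_upto /=.
  by case: (boolP (b \in B)) => //= /Bm ->.
- move=> P u [h1 h2] um; rewrite /F; case: ifPn => [/hf[h _]|uB'].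
    exact: (sol_in_rlideal hlt h h1).
  have h := sol_in_rlideal hlt (@monomial_fps_sol K n u) (h2 u um uB').
  exact: h.
Qed.
End ReducedBasis.

(** * The fiber at the origin *)

(** An independent family inside [H] is enlarged as long as possible; [k] bounds the number of rows
    that can still be added, as at most r rows are independent. *)
Lemma subspace_mx (K : fieldType) (r : nat) (H : 'rV[K]_r -> Prop) :
  H 0 -> (forall (a : K) u v, H u -> H v -> H (a *: u + v)) ->
  exists k (N : 'M[K]_(k, r)), row_free N /\ forall h, H h <-> (h <= N)%MS.
Proof.
move=> H0 HL.
have Hsub k (N : 'M_(k, r)) (h : 'rV_r) : (forall i, H (row i N)) -> (h <= N)%MS -> H h.
  move=> hN /submxP[y ->]; rewrite mulmx_sum_row.
  by elim/big_rec: _ => // i x _ hx; apply: HL.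
suff key k : forall p (N : 'M_(p, r)), (r <= p + k)%N -> row_free N -> (forall i, H (row i N)) ->
    exists q (N' : 'M[K]_(q, r)), row_free N' /\ forall h, H h <-> (h <= N')%MS.
  apply: (key r 0%N 0) => //; last by case.
  by rewrite /row_free mxrank0.
elim: k => [|k ih] p N hr fN hN.
  exists p, N; split=> // h; split=> [_|]; last exact: Hsub.
  apply: submx_full; rewrite /row_full eqn_leq rank_leq_col.
  by rewrite addn0 in hr; move/eqP: fN => ->.
have [[h [Hh hN']]|none] := Classical_Prop.classic (exists h, H h /\ ~~ (h <= N)%MS).
  apply: (ih _ (col_mx h N)).
  - by rewrite add1n addSnnS.
  - rewrite -kermx_eq0; apply/rowV0P => x /sub_kermxP.
    rewrite -[x]hsubmxK mul_row_col [lsubmx x]mx11_scalar mul_scalar_mx.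
    set a := lsubmx x 0 0; set y := rsubmx x; have [->|a0] := eqVneq a 0.
      rewrite scale0r add0r -(mul0mx _ N) => /(row_free_inj fN) ->.
      by rewrite raddf0 row_mx0.
    move/eqP; rewrite addr_eq0 => /eqP e; case/negP: hN'.
    by rewrite -(eqmx_scale h a0) e eqmx_opp submxMl.
  - move=> i; rewrite -(splitK i); case: (split i) => j /=.
      by rewrite rowKu; have -> : row j h = h by apply/rowP => l; rewrite !mxE ord1.
    by rewrite rowKd.
exists p, N; split=> // h; split=> [Hh|]; last exact: Hsub.
by apply: contraT => hn; case: none; exists h.
Qed.

Section Fiber.
Variables (K : fieldType) (n : nat) (lt : rel 'X_{1..n}).
Hypothesis charK : [pchar K] =i pred0.
Hypothesis hlt : graded_term_order lt.
Implicit Types (a b c : {mpoly K[n]}) (P Q : {mpoly {mpoly K[n]}[n]}) (u v w : 'X_{1..n}).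
Local Notation lte := (lte lt).

Variables (L : {mpoly {mpoly K[n]}[n]} -> Prop).
Hypothesis hL : left_ideal L.

(* P vanishes in the fiber A / (x A + L) at the origin of A / L, where A = K[x][d] *)
Definition vanishing P := exists2 Q, L Q & forall u, ((P - Q)@_u)@_0%MM = 0.

Lemma vanishing_max P : (forall u, (P@_u)@_0%MM = 0) -> vanishing P.
Proof. by move=> h; exists 0; [case: hL|move=> u; rewrite subr0]. Qed.

Lemma vanishing_ideal P : L P -> vanishing P.
Proof. by exists P => // u; rewrite subrr !mcoeff0. Qed.

Lemma vanishingD P Q : vanishing P -> vanishing Q -> vanishing (P + Q).
Proof.
case=> P' hP' hP [Q' hQ' hQ]; exists (P' + Q'); first by case: hL => _ D _ _; apply: D.
by move=> u; rewrite opprD addrACA (mcoeffD u (P - P')) (mcoeffD 0%MM) hP hQ addr0.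
Qed.

Lemma vanishingZ c P : vanishing P -> vanishing (c *: P).
Proof.
case=> Q LQ h; exists (c *: Q); first by case: hL => _ _ Z _; apply: Z.
by move=> u; rewrite -scalerBr mcoeffZ (rmorphM (mcoeff 0%MM)) /= h mulr0.
Qed.

Lemma vanishingB P Q : vanishing P -> vanishing Q -> vanishing (P - Q).
Proof. by move=> hP hQ; rewrite -scaleN1r; apply: vanishingD => //; apply: vanishingZ. Qed.

Lemma vanishing_sum (I : Type) (s : seq I) (p : pred I) F :
  (forall i, p i -> vanishing (F i)) -> vanishing (\sum_(i <- s | p i) F i).
Proof.
move=> h; elim/big_rec: _ => [|i x pi hx]; last exact: vanishingD (h i pi) hx.
by apply: vanishing_ideal; case: hL.
Qed.

Lemma vanishing_at0 P : vanishing (P - \sum_(u <- msupp P) ((P@_u)@_0)%:MP *: 'X_[u]).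
Proof.
apply: vanishing_max => v; rewrite mcoeffB mcoeffB raddf_sum.
have [vP|vP] := boolP (v \in msupp P).
  rewrite (bigD1_seq v) ?msupp_uniq //= mcoeffZ mcoeffX eqxx mulr1 big1 ?addr0.
    by rewrite mcoeffC eqxx mulr1 subrr.
  by move=> u uv; rewrite mcoeffZ mcoeffX (negPf uv) mulr0.
rewrite (memN_msupp_eq0 vP) mcoeff0 big_seq big1 ?mcoeff0 ?subrr // => u us.
rewrite /= mcoeffZ mcoeffX; case: (u =P v) => [e|_]; last by rewrite mulr0.
by rewrite -e us in vP.
Qed.

Variables (r : nat) (W : 'I_r -> 'X_{1..n}).
Hypothesis gen : forall P, exists c (a : 'I_r -> {mpoly K[n]}),
  c@_0 != 0 /\ L (c *: P - \sum_j a j *: 'X_[W j]).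

(** By [gen] the terms d^(W j) generate A / L over K[x]_(0). The fiber is thus K^r modulo the
    vectors [h] with [vanishing (E h)]. *)
Let E (h : 'rV[K]_r) : {mpoly {mpoly K[n]}[n]} := \sum_j (h 0 j)%:MP *: 'X_[W j].

Let E_lin (x : K) h h' : E (x *: h + h') = x%:MP *: E h + E h'.
Proof.
rewrite /E scaler_sumr -big_split; apply: eq_bigr => j _ /=.
by rewrite !mxE mpolyCD mpolyCM scalerDl scalerA.
Qed.

Lemma fiber_coord P : exists h, vanishing (P - E h).
Proof.
have [c [a [c0 hc]]] := gen P; pose k := (c@_0)^-1.
exists (\row_j (k * (a j)@_0)).
have -> : P - E (\row_j (k * (a j)@_0)) = (k%:MP) *: ((c *: P - \sum_j a j *: 'X_[W j]) +
   ((c@_0)%:MP - c) *: P + \sum_j (a j - ((a j)@_0)%:MP) *: 'X_[W j]).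
  have e1 : \sum_j (a j - ((a j)@_0)%:MP) *: 'X_[W j] =
      \sum_j a j *: 'X_[W j] - \sum_j ((a j)@_0)%:MP *: 'X_[W j] :> {mpoly {mpoly K[n]}[n]}.
    by rewrite -sumrB; apply: eq_bigr => j _; rewrite scalerBl.
  have eE : k%:MP *: (\sum_i ((a i)@_0)%:MP *: 'X_[W i]) = E (\row_j (k * (a j)@_0)).
    by rewrite /E scaler_sumr; apply: eq_bigr => j _; rewrite mxE scalerA mpolyCM.
  have eP : k%:MP *: ((c@_0)%:MP *: P) = P by rewrite scalerA -mpolyCM mulVf // scale1r.
  transitivity (k%:MP *: ((c@_0)%:MP *: P - \sum_i ((a i)@_0)%:MP *: 'X_[W i])).
    by rewrite scalerBr eP eE.
  rewrite e1 [(_%:MP - c) *: P]scalerBl; congr (_ *: _).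
  have tele (x y z t : {mpoly {mpoly K[n]}[n]}) : x - y = z - t + (x - z) + (t - y) by ring.
  exact: tele.
apply: vanishingZ; apply: vanishingD; first apply: vanishingD.
- exact: vanishing_ideal.
- apply: vanishing_max => u; rewrite mcoeffZ (rmorphM (mcoeff 0%MM)) /= mcoeffB mcoeffC eqxx mulr1.
  by rewrite subrr mul0r.
apply: vanishing_sum => j _; apply: vanishing_max => u.
rewrite mcoeffZ (rmorphM (mcoeff 0%MM)) /= mcoeffB mcoeffC eqxx mulr1.
by rewrite subrr mul0r.
Qed.

(** Elements of x A are expressed in the generators with coefficients in the maximal ideal, by
    expanding each d^u separately and multiplying by its coefficient in [P]. *)
Lemma maximal_lift P : (forall u, (P@_u)@_0%MM = 0) -> exists c (a : 'I_r -> {mpoly K[n]}),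
  [/\ c@_0 != 0, forall j, (a j)@_0 = 0 & L (c *: P - \sum_j a j *: 'X_[W j])].
Proof.
move=> hP; rewrite [P]mpolyE; elim: (msupp P) => [|u s [c [a [c0 a0 h]]]].
  exists 1, (fun=> 0); split=> //; first by rewrite mcoeff1 eqxx oner_neq0.
    by move=> j; rewrite mcoeff0.
  rewrite big_nil scaler0 sub0r big1 ?oppr0; first by case: hL.
  by move=> j _; rewrite scale0r.
have [c' [a' [c0' h']]] := gen 'X_[u].
exists (c * c'), (fun j => c' * a j + c * P@_u * a' j); split.
- by rewrite (rmorphM (mcoeff 0%MM)) mulf_neq0.
- by move=> j; rewrite mcoeffD !(rmorphM (mcoeff 0%MM)) /= a0 hP !(mulr0, mul0r) addr0.
have -> : (c * c') *: \sum_(v <- u :: s) P@_v *: 'X_[v] -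
    \sum_j (c' * a j + c * P@_u * a' j) *: 'X_[W j] =
  c' *: (c *: \sum_(v <- s) P@_v *: 'X_[v] - \sum_j a j *: 'X_[W j]) +
  (c * P@_u) *: (c' *: 'X_[u] - \sum_j a' j *: 'X_[W j]).
  have -> : \sum_j (c' * a j + c * P@_u * a' j) *: 'X_[W j] =
      c' *: (\sum_j a j *: 'X_[W j]) + (c * P@_u) *: (\sum_j a' j *: 'X_[W j])
      :> {mpoly {mpoly K[n]}[n]}.
    rewrite !scaler_sumr -big_split; apply: eq_bigr => j _ /=.
    by rewrite scalerDl !scalerA.
  rewrite big_cons -!mul_mpolyC !mpolyCM.
  have tele (x y z s1 s2 s3 t : {mpoly {mpoly K[n]}[n]}) :
    x * y * (z * t + s1) - (y * s2 + x * z * s3) = y * (x * s1 - s2) + x * z * (y * t - s3)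
    by ring.
  exact: tele.
by case: hL => _ D Z _; apply: D; apply: Z.
Qed.

(** A relation in the fiber lifts to one modulo [L]: up to [L] the element [E h] lies in x A, and
    rewriting it by [maximal_lift] changes the coefficients only by elements vanishing at the
    origin. *)
Lemma fiber_relation h : vanishing (E h) -> exists b : 'rV[{mpoly K[n]}]_r, exists2 k : K,
  k != 0 & (forall j, (b 0 j)@_0 = k * h 0 j) /\ L (\sum_j b 0 j *: 'X_[W j]).
Proof.
case=> Q LQ /maximal_lift[c [a [c0 a0 hc]]].
exists (\row_j (c * (h 0 j)%:MP - a j)), c@_0 => //; split=> [j|].
  by rewrite mxE mcoeffB (rmorphM (mcoeff 0%MM)) /= mcoeffC eqxx mulr1 a0 subr0.
have -> : \sum_j (\row_j (c * (h 0 j)%:MP - a j)) 0 j *: 'X_[W j] =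
    (c *: (E h - Q) - \sum_j a j *: 'X_[W j]) + c *: Q.
  rewrite scalerBr addrAC subrK /E scaler_sumr -sumrB; apply: eq_bigr => j _.
  by rewrite mxE scalerBl scalerA.
by case: hL => _ D Z _; apply: D => //; apply: Z.
Qed.

(** The k lifted relations stay independent over K(x), being so at the origin. Thus r generators
    with k relations leave rank at most r - k, while the d^(e i) are d independent elements. *)
Lemma fiber_rank d k (e : 'I_d -> 'X_{1..n}) (N : 'M[K]_(k, r)) :
  (forall x : 'I_d -> {mpoly K[n]}, L (\sum_i x i *: 'X_[e i]) -> forall i, x i = 0) ->
  row_free N -> (forall i, vanishing (E (row i N))) -> (d + k <= r)%N.
Proof.
move=> free fN hN; have [L0 LD LZ _] := hL.
have [b hb] := fin_all_exists (fun i => fiber_relation (hN i)).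
have [s s0 hs] := fin_all_exists2 hb.
have [c hc] := fin_all_exists (fun i => gen 'X_[e i]).
have [a ha] := fin_all_exists hc.
rewrite leqNgt; apply/negP=> rlt.
pose A := \matrix_(i < d, w < r) a i w; pose B := \matrix_(j < k, w < r) b j 0 w.
have [x x0] := left_kernel_wide (col_mx A B) rlt.
rewrite -[x]hsubmxK in x0 *; move: (lsubmx x) (rsubmx x) x0 => y z x0.
rewrite mul_row_col => /eqP; rewrite addr_eq0 => /eqP yA.
have LzB : L (\sum_w (z *m B) 0 w *: 'X_[W w]).
  have -> : \sum_w (z *m B) 0 w *: 'X_[W w] = \sum_j z 0 j *: (\sum_w b j 0 w *: 'X_[W w])
      :> {mpoly {mpoly K[n]}[n]}.
    under [RHS]eq_bigr => j _ do rewrite scaler_sumr.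
    rewrite [RHS]exchange_big /=; apply: eq_bigr => w _.
    rewrite mxE scaler_suml; apply: eq_bigr => j _.
    by rewrite [B j w]mxE scalerA.
  by apply: left_ideal_sum => // j _; apply: LZ; case: (hs j).
have y0 : y = 0.
  suff Ly : L (\sum_i (y 0 i * c i) *: 'X_[e i]).
    apply/rowP => i; have /eqP := free _ Ly i; rewrite mxE mulf_eq0 => /orP[/eqP//|/eqP ci].
    by have [] := ha i; rewrite ci mcoeff0 eqxx.
  have -> : \sum_i (y 0 i * c i) *: 'X_[e i] =
      \sum_i y 0 i *: (c i *: 'X_[e i] - \sum_w a i w *: 'X_[W w]) -
      \sum_w (z *m B) 0 w *: 'X_[W w] :> {mpoly {mpoly K[n]}[n]}.
    have -> : \sum_w (z *m B) 0 w *: 'X_[W w] = - \sum_i y 0 i *: (\sum_w a i w *: 'X_[W w])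
        :> {mpoly {mpoly K[n]}[n]}.
      under [in RHS]eq_bigr => i _ do rewrite scaler_sumr.
      rewrite [in RHS]exchange_big /= -sumrN; apply: eq_bigr => w _.
      rewrite -[z *m B]opprK -yA mxE scaleNr mxE scaler_suml; congr (- _).
      by apply: eq_bigr => i _; rewrite [A i w]mxE scalerA.
    under [in RHS]eq_bigr => i _ do rewrite scalerBr scalerA.
    by rewrite sumrB opprK subrK.
  apply: (left_idealB hL) => //; apply: left_ideal_sum => // i _; apply: LZ.
  by case: (ha i).
have zB : z *m B = 0 by rewrite -[z *m B]opprK -yA y0 mul0mx oppr0.
have z0 : z != 0 by apply: contra_neq x0 => ->; rewrite y0 row_mx0.
have [j zj] := rV0Pn _ z0.
have [u0 hu0 _] := mpoly_lowest hlt zj.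
(* The lowest exponent over all entries of [z]: comparing the coefficients of x^u in z B = 0 gives a
   dependence over K between the rows of [N], scaled by the factors [s j]. *)
have [u [i zi] hu] := lt_min_exists hlt
  (ex_intro (fun u => exists j, (z 0 j)@_u != 0) u0 (ex_intro _ j hu0)).
suff z1 : \row_j ((z 0 j)@_u * s j) = 0.
  have := congr1 (fun M : 'rV_k => M 0 i) z1; rewrite !mxE => /eqP.
  by rewrite mulf_eq0 (negPf zi) (negPf (s0 i)).
apply: (row_free_inj fN); rewrite mul0mx; apply/rowP => w.
have := congr1 (fun M : 'rV_r => (M 0 w)@_(u + 0)) zB; rewrite !mxE mcoeff0 => E0.
rewrite -[RHS]E0 raddf_sum; apply: eq_bigr => l _ /=.
rewrite (mcoeffM_lowest hlt) => [|v hv|v _]; last exact: lte0m.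
  by rewrite !mxE -mulrA; case: (hs l) => ->; rewrite mxE.
by apply: hu; exists l.
Qed.

Lemma fiber_solutions d (e : 'I_d -> 'X_{1..n}) :
  (forall x : 'I_d -> {mpoly K[n]}, L (\sum_i x i *: 'X_[e i]) -> forall i, x i = 0) ->
  exists fs : 'I_d -> fps K n,
    (forall i P, L P -> annihilator (fs i) P) /\ fps_lin_indep fs.
Proof.
move=> free; have EL := E_lin.
have [||k [N [fN hN]]] := @subspace_mx K r (fun h => vanishing (E h)).
- by apply: vanishing_ideal; rewrite /E big1 => [|j _]; [case: hL|rewrite mxE mpolyC0 scale0r].
- by move=> x h h' hh hh'; rewrite EL; apply: vanishingD => //; apply: vanishingZ.
have dk := @fiber_rank d k e N free fN (fun i => (hN (row i N)).2 (row_sub i N)).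
(* d solutions, as functionals on K^r orthogonal to all relations *)
pose ker := kermx N^T.
have rk : \rank ker = (r - k)%N by rewrite mxrank_ker mxrank_tr (eqP fN).
(* The first d rows of a basis of the forms vanishing on all relations; [fiber_rank] guarantees that
   there are r - k >= d of them. *)
pose Y : 'M[K]_(d, r) := pid_mx d *m row_base ker.
have fY : row_free Y.
  rewrite /row_free mxrankMfree ?row_base_free // rank_pid_mx // rk.
  by rewrite leq_subRL ?(leq_trans (leq_addl d k) dk) // addnC.
have YN h : (h <= N)%MS -> Y *m h^T = 0.
  case/submxP => x ->; rewrite trmx_mul mulmxA.
  have -> : Y *m N^T = 0; last by rewrite mul0mx.
  apply/sub_kermxP; apply: submx_trans (submxMl _ _) _.
  by rewrite eq_row_base.
(* [al u] are coordinates of d^u in the fiber, unique only up to relations, on which [Y] vanishes.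
   Dividing by u! makes the value of P f at the origin equal to the form applied to the class of
   [P]. *)
have [al hal] := IndefiniteDescription.functional_choice _ (fun u => fiber_coord 'X_[u]).
pose lam i u := (Y *m (al u)^T) i 0.
pose fs i : fps K n := fun u => lam i u / (mfact u)%:R.
have fsE i u : (mfact u)%:R * fs i u = lam i u.
  by rewrite mulrC divfK // mfact_neq0.
exists fs; split.
- move=> i; apply: (annihilator_at0 charK hL) => P LP; rewrite op_apply_at0.
  under eq_bigr => u _ do rewrite fsE.
  pose h := \sum_(u <- msupp P) (P@_u)@_0 *: al u.
  have -> : \sum_(u <- msupp P) (P@_u)@_0 * lam i u = (Y *m h^T) i 0.
    rewrite /h raddf_sum mulmx_sumr summxE; apply: eq_bigr => u _.
    by rewrite /= linearZ /= -scalemxAr [RHS]mxE.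
  rewrite YN ?mxE //; apply/hN.
  have hE : E h = \sum_(u <- msupp P) ((P@_u)@_0)%:MP *: E (al u).
    rewrite /h; elim: (msupp P) => [|u s ih].
      by rewrite !big_nil /E big1 // => j _; rewrite mxE mpolyC0 scale0r.
    by rewrite !big_cons EL ih.
  rewrite hE; have -> : \sum_(u <- msupp P) ((P@_u)@_0)%:MP *: E (al u) =
     P - (P - \sum_(u <- msupp P) ((P@_u)@_0)%:MP *: 'X_[u]) -
     \sum_(u <- msupp P) ((P@_u)@_0)%:MP *: ('X_[u] - E (al u)).
    under [X in _ - _ - X]eq_bigr => u _ do rewrite scalerBr.
    rewrite sumrB.
    have tele (x y z : {mpoly {mpoly K[n]}[n]}) : y = x - (x - z) - (z - y) by ring.
    exact: tele.
  apply: vanishingB; last by apply: vanishing_sum => u _; apply: vanishingZ; apply: hal.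
  by apply: vanishingB; [apply: vanishing_ideal|apply: vanishing_at0].
(* A form that vanishes on every d^u vanishes in particular on the generators d^(W j), hence is
   zero; the rows of [Y] are independent. *)
move=> c hc; pose cr := \row_i c i; pose y := cr *m Y.
have yal u : y *m (al u)^T = 0.
  rewrite -mulmxA; apply/rowP => j; rewrite ord1 !mxE.
  have := congr1 (fun x => (mfact u)%:R * x) (hc u); rewrite /= mulr0 mulr_sumr => E0.
  by rewrite -[RHS]E0; apply: eq_bigr => i _; rewrite mulrCA fsE mxE.
have y0 : y = 0.
  apply/rowP => j; rewrite mxE; pose dj : 'rV[K]_r := delta_mx 0 j.
  have Ej : E dj = 'X_[W j].
    rewrite /E (bigD1 j) //= mxE !eqxx mpolyC1 scale1r big1 ?addr0 // => l lj.
    by rewrite mxE (negPf lj) mpolyC0 scale0r.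
  have : vanishing (E (dj - al (W j))).
    rewrite addrC -scaleN1r EL Ej mpolyCN mpolyC1 scaleN1r addrC; exact: hal.
  move/hN/YN => h.
  have e1 : Y *m dj^T = Y *m (al (W j))^T by apply/eqP; rewrite -subr_eq0 -mulmxBr -linearB h.
  have : col j y = 0 by rewrite colE -trmx_delta -/dj -mulmxA e1 mulmxA yal.
  by move/colP/(_ 0); rewrite !mxE.
have : cr = 0 by apply: (row_free_inj fY); rewrite mul0mx.
by move/rowP => h i; have := h i; rewrite !mxE.
Qed.
End Fiber.

(** * From an ordinary point of the intersection ideal to solutions *)

Section Converse.
Variables (K : fieldType) (n : nat) (lt : rel 'X_{1..n}).
Hypothesis charK : [pchar K] =i pred0.
Hypothesis hlt : graded_term_order lt.

Lemma bounded_seq_exists (I : eqType) (Q : pred I) N :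
  (forall s, uniq s -> {subset s <= Q} -> (size s <= N)%N) ->
  exists s, uniq s /\ forall x, (x \in s) = Q x.
Proof.
move=> bound; suff key k s : uniq s -> {subset s <= Q} -> (N <= size s + k)%N ->
    exists s, uniq s /\ forall x, (x \in s) = Q x by apply: (key N [::]).
elim: k s => [|k ih] s us sQ hs.
  exists s; split=> // x; apply/idP/idP => [/sQ//|Qx]; apply: contraT => xs.
  have := bound (x :: s); rewrite /= us xs => /(_ isT) h.
  suff : (size s < N)%N by rewrite addn0 in hs; rewrite ltnNge hs.
  by apply: h => y; rewrite inE => /orP[/eqP->|/sQ].
have [[x [xs Qx]]|none] := Classical_Prop.classic (exists x, x \notin s /\ Q x).
  apply: (ih (x :: s)) => /=; first by rewrite xs.
    by move=> y; rewrite inE => /orP[/eqP->|/sQ].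
  by rewrite addSnnS.
exists s; split=> // x; apply/idP/idP => [/sQ//|Qx]; apply: contraT => xs.
by case: none; exists x.
Qed.

Lemma ordinary0_hcoeff (M : seq {mpoly {mpoly K[n]}[n]}) g :
  ordinary0 lt M -> g \in M -> (hcoeff lt g)@_0 != 0.
Proof.
move=> hM gM; apply/eqP => g0; have [l hl] := is_lcm_exists [seq hcoeff lt g | g <- M].
apply: hM; exists l; split=> //; have [|q ->] := (proj1 hl) (hcoeff lt g).
  exact: map_f.
by rewrite mevalM !mevals0 g0 mulr0.
Qed.

Lemma GB_independent L G (s : seq 'X_{1..n}) (x : 'I_(size s) -> {mpoly K[n]}) :
  @is_GB K n lt L G -> uniq s -> {subset s <= parametric lt G} ->
  L (\sum_(i < size s) x i *: 'X_[nth 0%MM s i]) -> forall i, x i = 0.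
Proof.
move=> hG us sG LP; set P := \sum_i _ in LP.
have PE (i : 'I_(size s)) : P@_(nth 0%MM s i) = x i.
  rewrite /P raddf_sum (bigD1 i) //= mcoeffZ mcoeffX eqxx mulr1 big1 ?addr0 // => l lk.
  by rewrite mcoeffZ mcoeffX nth_uniq // val_eqE (negPf lk) mulr0.
have P0 : P = 0.
  apply: (GB_free hlt hG LP) => u; apply: contraNT => uG; apply/eqP.
  rewrite /P raddf_sum big1 // => i _ /=; rewrite mcoeffZ mcoeffX.
  case: (_ =P u) => [E|]; last by rewrite mulr0.
  by case/negP: uG; rewrite -E; apply: sG; apply: mem_nth.
by move=> i; rewrite -PE P0 mcoeff0.
Qed.

Lemma ordinary_solutions G m B M d :
  is_GB lt (in_rlideal G) G -> is_rank lt G d -> is_GB lt (@inter_ideal K n G m B) M ->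
  ordinary0 lt M ->
  exists fs : 'I_d -> fps K n, (forall i, is_fps_sol G (fs i)) /\ fps_lin_indep fs.
Proof.
move=> hG hd hM ordM; have hL := inter_ideal_left_ideal G m B.
have [s [us hs]] : exists s, uniq s /\ forall u, (u \in s) = parametric lt M u.
  (* Parametric terms of [M] are independent modulo the intersection ideal, so its rank bounds their
     number and they form a finite list. *)
  apply: (@bounded_seq_exists _ _ (d + size [seq u <- exps_upto n m | u \notin B])) => s us sM.
  rewrite leqNgt; apply/negP => hlt'.
  have [x [[j xj] LP]] := rank_le_dependent
    (fun i : 'I_(size s) => 'X_[nth 0%MM s i]) (rank_inter_ideal hlt m B hG hd) hlt'.
  by rewrite (GB_independent hM us sM LP) eqxx in xj.
have gen P : exists c (a : 'I_(size s) -> {mpoly K[n]}),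
    c@_0 != 0 /\ in_rlideal G (c *: P - \sum_j a j *: 'X_[nth 0%MM s j]).
  (* The head coefficients of [M] are nonzero at the origin, so the reduction needs only
     denominators invertible there; of the resulting membership in the intersection, the part about
     [G] is kept. *)
  have [|||c [Q [c0 [LQ _] hQ]]] :=
      reduction hlt (Z := fun c => c@_0 != 0) hL (proj1 hM) _ _ _ P.
  - by rewrite mcoeff1 eqxx oner_neq0.
  - by move=> a b a0 b0; rewrite (rmorphM (mcoeff 0%MM)) mulf_neq0.
  - by move=> g gM; apply: (ordinary0_hcoeff ordM gM).
  exists c, (fun j => Q@_(nth 0%MM s j)); split=> //.
  by rewrite -mpoly_sum_nth // => u /hQ; rewrite hs.
have [t [ut ht td]] := hd; rewrite -td.
have [|fs [h1 h2]] := fiber_solutions charK hlt (in_rlideal_left_ideal G) gen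
  (e := fun i : 'I_(size t) => nth 0%MM t i).
  by move=> x; apply: (GB_independent hG ut) => u; rewrite ht.
by exists fs; split=> // i g gG; apply: h1; apply: mem_in_rlideal.
Qed.
End Converse.

Theorem mainTheorem6 (K : fieldType) (n : nat) (lt : rel 'X_{1..n})
    (G : seq {mpoly {mpoly K[n]}[n]}) (d : nat) (S : seq 'X_{1..n}) :
  [pchar K] =i pred0 ->
  graded_term_order lt ->
  is_GB lt (in_rlideal G) G ->
  dfinite G ->
  is_rank lt G d ->
  singular0 lt G ->
  is_cand_set lt G S ->
  (d <= size S)%N ->
  let m := (\max_(u <- S) mdeg u)%N in
  apparent0 lt G d <->
  exists B : seq 'X_{1..n},
    [/\ uniq B, {subset B <= S}, size B = d &
        exists M : seq {mpoly {mpoly K[n]}[n]},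
          is_reduced_GB lt (inter_ideal G m B) M /\ ordinary0 lt M].
Proof.
move=> charK hlt hG _ hd sing hS _ m; split=> [[_ hfs]|[B [_ _ _ [M [[hM _ _ _] ordM]]]]].
  exact: (apparent_ordinary charK hlt hG hd hS hfs).
by split=> //; apply: (ordinary_solutions charK hlt hG hd hM ordM).
Qed.
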